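(* Let $k$ be a positive integer. Then, as ordered rings, $$K_0\big(A(\mathbf{Rep}_k(\mathrm{G}_2),\pi_{(1,0)})\big)\cong\mathbb{Z}[s,t]/I_k,$$ where $$I_k=\big\langle\{P^{\mathrm{G}_2}_{\vec\lambda}(s,t)\,:\,\vec\lambda\in\mathbb{N}_0^2,\ \lambda_1+2\lambda_2=k+1\}\cup\{P^{\mathrm{G}_2}_{(k+2,0)}(s,t)\}\big\rangle .$$ Here, for $\vec\lambda=(\lambda_1,\lambda_2)\in\mathbb{N}_0^2$, the polynomial $P^{\mathrm{G}_2}_{\vec\lambda}(s,t)$ is obtained from the Laurent polynomial $x^{-(\lambda_1+2\lambda_2)}Q^{\mathrm{G}_2}_{\vec\lambda}(x,y)$ by the change of variables $(s,t)=(1/x,\,y/x^2)$, and the positive cone on the right-hand side is $$\big(\mathbb{Z}[s,t]/I_k\big)_+=\{[p(s,t)]\,:\,p(\beta_{k,1},\beta_{k,2})>0\}\cup\{[0]\},$$ where $\beta_{k,1}=d(\pi_{(1,0)})^{-1}$ and $\beta_{k,2}=d(\pi_{(1,0)})^{-2}d(\pi_{(0,1)})$.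
   Context: The representation ring of the compact Lie group $\mathrm{G}_2$ is $\mathbb{Z}[x,y]$, where $x$ is the class of the fundamental representation with Dynkin labels $(1,0)$ (of dimension 7) and $y$ that of the fundamental representation with Dynkin labels $(0,1)$ (the adjoint representation, of dimension 14). $Q^{\mathrm{G}_2}_{\vec\lambda}(x,y)\in\mathbb{Z}[x,y]$ is the polynomial representing the irreducible representation with Dynkin labels $\vec\lambda\in\mathbb{N}_0^2$. $\mathbf{Rep}_k(\mathrm{G}_2)$ is the braided C*-tensor category (unitary modular tensor category) of the level $k$ Wess–Zumino–Witten model for $\mathrm{G}_2$. Its simple objects are $\pi_{\vec\lambda}$, $\vec\lambda\in\mathbb{N}_0^2$ with $\lambda_1+2\lambda_2\le k$; all are self-conjugate. Its fusion ring, the Verlinde ring $\mathrm{Ver}_k(\mathrm{G}_2)$, is $\mathbb{Z}[x,y]/J_k$ with $J_k=\langle\{Q^{\mathrm{G}_2}_{\vec\lambda}:\lambda_1+2\lambda_2=k+1\}\cup\{Q^{\mathrm{G}_2}_{(k+2,0)}\}\rangle$, where $\pi_{\vec\lambda}\leftrightarrow[Q^{\mathrm{G}_2}_{\vec\lambda}]$. $d$ is the quantum dimension: the ring homomorphism from the fusion ring to $\mathbb{R}$ that is positive on simple objects; $d(\pi_{(1,0)})$ and $d(\pi_{(0,1)})$ denote the values of $d$ at $[x]$ and $[y]$ (so for $k=1$, where $y\in J_1$, one has $d(\pi_{(0,1)})=0$). The point $(\beta_{k,1},\beta_{k,2})$ is a common zero of the polynomials in $I_k$. For a braided C*-tensor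 category $\mathcal{C}$ and an object $\pi$, put $\sigma=\bar\pi\otimes\pi$; $A(\mathcal{C},\pi)$ is the unital AF-algebra $\varinjlim_n\mathrm{End}(\sigma^{\otimes n})$ with connecting maps $T\mapsto T\otimes\mathrm{id}_\sigma$. As an ordered group, $K_0(A(\mathcal{C},\pi))$ is the limit of $\cdots\to\bigoplus_{\mu\prec\sigma^{\otimes n}}\mathbb{Z}\mu\to\bigoplus_{\mu\prec\sigma^{\otimes(n+1)}}\mathbb{Z}\mu\to\cdots$, where $\mu$ ranges over simple summands of $\sigma^{\otimes n}$, the connecting maps are multiplication by $\sigma$ in the fusion ring $F_{\mathcal{C}}$, and each group has the cone of non-negative coefficients. The ring structure on $K_0(A(\mathcal{C},\pi))$ is the one induced by the $*$-homomorphism $\theta\colon A(\mathcal{C},\pi)\otimes A(\mathcal{C},\pi)\to A(\mathcal{C},\pi)$ given on $\mathrm{End}(\sigma^{\otimes n})\otimes\mathrm{End}(\sigma^{\otimes n})$ by $T_1\otimes T_2\mapsto U_n(T_1\otimes T_2)U_n^*\in\mathrm{End}(\sigma^{\otimes 2n})$, where $U_1=\mathrm{id}$, $U_{n+1}=\mathrm{id}_\sigma\otimes(c_{\sigma,\sigma}^{\otimes n}U_n)\otimes\mathrm{id}_\sigma$ and $c$ is the braiding; concretely, the product of the class of $\mu$ at stage $n$ and the class of $\nu$ at stage $n$ is the class of $\mu\cdot\nu\in F_{\mathcal{C}}$ at stage $2n$, so $\mu$ at stage $n$ $\mapsto\mu/\sigma^n$ is an injective ring homomorphism into the localization $F_{\mathcal{C}}[\sigma^{-1}]$.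 An ordered ring is a commutative unital ring $R$ with a subset $R_+$ satisfying $R_++R_+\subset R_+$, $R_+\cap(-R_+)=\{0\}$, $R=R_+-R_+$, $R_+\cdot R_+\subset R_+$, and such that $1$ is an order unit; isomorphisms of ordered rings are ring isomorphisms mapping positive cone onto positive cone. *)

(* Defs.v *)
From HB Require Import structures.
From mathcomp Require Import all_boot all_order all_algebra.
From mathcomp Require Import boolp classical_sets reals.
From mathcomp Require Import zify.
From mathcomp Require Import mpoly.

Set Implicit Arguments.
Unset Strict Implicit.
Unset Printing Implicit Defensive.

Import Order.TTheory GRing.Theory Num.Theory.

Local Open Scope classical_set_scope.
Local Open Scope ring_scope.
Local Open Scope quotient_scope.

(* The quotient is built here, rather than with [{ideal_quot _}], because the
   latter asks for an ideal already known to be proper. *)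

Definition is_ideal (A : comPzRingType) (I : set A) : Prop :=
  [/\ I 0, forall a b, I a -> I b -> I (a + b)
    & forall a b, I b -> I (a * b)].

Definition ideal_gen (A : comPzRingType) (S : set A) : set A :=
  [set a | forall I : set A, is_ideal I -> S `<=` I -> I a].

Lemma ideal_gen_is_ideal (A : comPzRingType) (S : set A) :
  is_ideal (ideal_gen S).
Proof.
split=> [I [] // | a b Ia Ib I iI SI | a b Ib I iI SI].
- by case: (iI) => _ ID _; apply: ID; [apply: Ia | apply: Ib].
- by case: (iI) => _ _; apply; apply: Ib.
Qed.

Section RingQuotient.
Variables (A : comPzRingType) (S : set A).

Definition ideal_eqv (a b : A) : bool := `[< ideal_gen S (a - b) >].

Let I0 : ideal_gen S 0. Proof. by have [] := ideal_gen_is_ideal S. Qed.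
Let ID a b : ideal_gen S a -> ideal_gen S b -> ideal_gen S (a + b).
Proof. by have [_ h _] := ideal_gen_is_ideal S; apply: h. Qed.
Let IM a b : ideal_gen S b -> ideal_gen S (a * b).
Proof. by have [_ _ h] := ideal_gen_is_ideal S; apply: h. Qed.
Let IN a : ideal_gen S a -> ideal_gen S (- a).
Proof. by rewrite -mulN1r; apply: IM. Qed.

Lemma ideal_eqv_equiv : equiv_class_of ideal_eqv.
Proof.
split=> [a | a b | b a c].
- by apply/asboolP; rewrite subrr.
- by apply/asboolP/asboolP => /IN; rewrite opprB.
- move=> /asboolP ab /asboolP bc; apply/asboolP.
  by have := ID ab bc; rewrite addrA subrK.
Qed.

Canonical ideal_eqv_rel := EquivRelPack ideal_eqv_equiv.

Definition ring_quot := {eq_quot ideal_eqv}.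
HB.instance Definition _ := EqQuotient.on ring_quot.
HB.instance Definition _ := Choice.on ring_quot.

Definition ring_class (a : A) : ring_quot := \pi_ring_quot a.

Lemma ring_classP a b : ring_class a = ring_class b <-> ideal_gen S (a - b).
Proof.
split=> [/eqmodP/asboolP // | Iab].
by apply/eqmodP/asboolP.
Qed.

Lemma ring_classW (P : ring_quot -> Prop) :
  (forall a, P (ring_class a)) -> forall u, P u.
Proof. by move=> h u; rewrite -[u]reprK. Qed.

Definition rq_add (u v : ring_quot) := ring_class (repr u + repr v).
Definition rq_opp (u : ring_quot) := ring_class (- repr u).
Definition rq_mul (u v : ring_quot) := ring_class (repr u * repr v).

Let reprI a : ideal_gen S (repr (ring_class a) - a).
Proof. by apply/ring_classP; rewrite /ring_class reprK. Qed.

Lemma rq_addE a b :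
  rq_add (ring_class a) (ring_class b) = ring_class (a + b).
Proof. by apply/ring_classP; rewrite opprD addrACA; apply: ID; apply: reprI. Qed.

Lemma rq_oppE a : rq_opp (ring_class a) = ring_class (- a).
Proof. by apply/ring_classP; rewrite -opprD; apply: IN; apply: reprI. Qed.

Lemma rq_mulE a b :
  rq_mul (ring_class a) (ring_class b) = ring_class (a * b).
Proof.
apply/ring_classP; set x := repr _; set y := repr _.
have -> : x * y - a * b = y * (x - a) + a * (y - b).
  by rewrite !mulrBr addrA [y * a]mulrC subrK mulrC.
by apply: ID; apply: IM; apply: reprI.
Qed.

Fact rq_addA : associative rq_add.
Proof.
elim/ring_classW=> a; elim/ring_classW=> b; elim/ring_classW=> c.
by rewrite !rq_addE addrA.
Qed.
Fact rq_addC : commutative rq_add.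
Proof.
by elim/ring_classW=> a; elim/ring_classW=> b; rewrite !rq_addE addrC.
Qed.
Fact rq_add0 : left_id (ring_class 0) rq_add.
Proof. by elim/ring_classW=> a; rewrite rq_addE add0r. Qed.
Fact rq_addN : left_inverse (ring_class 0) rq_opp rq_add.
Proof. by elim/ring_classW=> a; rewrite rq_oppE rq_addE addNr. Qed.
Fact rq_mulA : associative rq_mul.
Proof.
elim/ring_classW=> a; elim/ring_classW=> b; elim/ring_classW=> c.
by rewrite !rq_mulE mulrA.
Qed.
Fact rq_mulC : commutative rq_mul.
Proof.
by elim/ring_classW=> a; elim/ring_classW=> b; rewrite !rq_mulE mulrC.
Qed.
Fact rq_mul1 : left_id (ring_class 1) rq_mul.
Proof. by elim/ring_classW=> a; rewrite rq_mulE mul1r. Qed.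
Fact rq_mulD : left_distributive rq_mul rq_add.
Proof.
elim/ring_classW=> a; elim/ring_classW=> b; elim/ring_classW=> c.
by rewrite !(rq_addE, rq_mulE) mulrDl.
Qed.

HB.instance Definition _ :=
  GRing.isZmodule.Build ring_quot rq_addA rq_addC rq_add0 rq_addN.
HB.instance Definition _ :=
  GRing.Zmodule_isComPzRing.Build ring_quot rq_mulA rq_mulC rq_mul1 rq_mulD.

Fact ring_class_is_zmod_morphism : zmod_morphism ring_class.
Proof. by move=> a b; rewrite -rq_addE -rq_oppE. Qed.
Fact ring_class_is_monoid_morphism : monoid_morphism ring_class.
Proof. by split=> // a b; rewrite -rq_mulE. Qed.
HB.instance Definition _ :=
  GRing.isZmodMorphism.Build A ring_quot ring_class ring_class_is_zmod_morphism.
HB.instance Definition _ :=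
  GRing.isMonoidMorphism.Build A ring_quot ring_class
    ring_class_is_monoid_morphism.

End RingQuotient.

Definition ordered_ring (A : comPzRingType) (P : set A) : Prop :=
  [/\ forall a b, P a -> P b -> P (a + b),
      forall a, (P a /\ P (- a)) <-> a = 0,
      forall a, exists b c, [/\ P b, P c & a = b - c],
      forall a b, P a -> P b -> P (a * b)
    & P 1 /\ forall a, exists n : nat, P (n%:R - a)].

Definition ordered_ring_iso (A : comPzRingType) (P : set A)
    (B : comPzRingType) (Q : set B) : Prop :=
  [/\ ordered_ring P, ordered_ring Q
    & exists f : {rmorphism A -> B}, bijective f /\ f @` P = Q].

(* The fusion ring of a braided C*-tensor category with finitely many simple
   objects: [cls i] is the class of the simple object [i], [coef f i] is the
   coefficient of [cls i] in [f], and [coef (cls i * cls j) l] is the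
   multiplicity of [l] in the tensor product of [i] and [j]. *)
Record fusion_ring := FusionRing {
  fusion_car :> comPzRingType;
  simple : finType;
  cls : simple -> fusion_car;
  coef : {additive fusion_car -> {ffun simple -> int}};
  coefK : forall f, f = \sum_i cls i *~ coef f i;
  coef_cls : forall i j, coef (cls i) j = (i == j)%:R;
  unit_obj : simple;
  cls_unit : cls unit_obj = 1;
  coef_ge0 : forall i j l, 0 <= coef (cls i * cls j) l;
  conj_obj : simple -> simple;
  coef_conj : forall i j,
    coef (cls i * cls j) unit_obj = (j == conj_obj i)%:R;
  coef_conj_conj : forall i j l,
    coef (cls (conj_obj i) * cls (conj_obj j)) (conj_obj l)
    = coef (cls i * cls j) l
}.
Arguments cls {_}.
Arguments coef {_}.
Arguments conj_obj {_}.

Section K0.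
Variables (C : fusion_ring) (p : simple C).

Definition sigma : C := cls (conj_obj p) * cls p.

(* [f] lies in the free group on the simple summands of the [n]-th tensor power
   of sigma. *)
Definition in_stage (n : nat) (f : C) : bool :=
  [forall i, (coef f i != 0) ==> (coef (sigma ^+ n) i != 0)].

Lemma in_stageP n f :
  reflect (forall i, coef f i != 0 -> coef (sigma ^+ n) i != 0) (in_stage n f).
Proof.
by apply: (iffP forallP) => h i; [move/implyP: (h i) | apply/implyP/(h i)].
Qed.

Lemma coef_sum_cls (c : simple C -> int) j :
  coef (\sum_i cls i *~ c i : C) j = c j.
Proof.
rewrite raddf_sum sum_ffunE (bigD1 j) //= big1 => [|i nij].
  by rewrite raddfMz ffunMzE coef_cls eqxx addr0 intz.
by rewrite raddfMz ffunMzE coef_cls (negPf nij) mul0rz.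
Qed.

Lemma coefM (f g : C) l :
  coef (f * g) l =
  \sum_i \sum_j coef f i * coef g j * coef (cls i * cls j) l.
Proof.
rewrite {1}[f]coefK {1}[g]coefK mulr_suml raddf_sum sum_ffunE.
apply: eq_bigr => i _; rewrite mulr_sumr raddf_sum sum_ffunE.
apply: eq_bigr => j _.
rewrite mulrzAl mulrzAr -mulrzA raddfMz ffunMzE mulrzz.
by rewrite mulrC [coef g j * _]mulrC.
Qed.

Lemma coef_mul_ge0 (f g : C) :
  (forall i, 0 <= coef f i) -> (forall i, 0 <= coef g i) ->
  forall l, 0 <= coef (f * g) l.
Proof.
move=> f0 g0 l; rewrite coefM; apply: sumr_ge0 => i _; apply: sumr_ge0 => j _.
by rewrite !mulr_ge0 // coef_ge0.
Qed.

Lemma coef_sigmaX_ge0 n i : 0 <= coef (sigma ^+ n) i.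
Proof.
elim: n i => [|n IH] i; first by rewrite expr0 -cls_unit coef_cls.
by rewrite exprS; apply: coef_mul_ge0 => // j; apply: coef_ge0.
Qed.

Lemma in_stage0 n : in_stage n 0.
Proof. by apply/in_stageP => i; rewrite raddf0 ffunE eqxx. Qed.

Lemma in_stage_sigmaX n : in_stage n (sigma ^+ n).
Proof. exact/in_stageP. Qed.

Lemma in_stageN n f : in_stage n f -> in_stage n (- f).
Proof.
move=> /in_stageP h; apply/in_stageP => i.
by rewrite raddfN ffunE oppr_eq0; apply: h.
Qed.

Lemma in_stageD n f g : in_stage n f -> in_stage n g -> in_stage n (f + g).
Proof.
move=> /in_stageP hf /in_stageP hg; apply/in_stageP => i.
rewrite raddfD ffunE; have [-> | /hf //] := eqVneq (coef f i) 0.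
by rewrite add0r; apply: hg.
Qed.

Lemma in_stageM n m f g :
  in_stage n f -> in_stage m g -> in_stage (n + m) (f * g).
Proof.
move=> /in_stageP hf /in_stageP hg; apply/in_stageP => l; apply: contraNneq.
rewrite exprD !coefM => s0.
have t0 i j : coef (sigma ^+ n) i * coef (sigma ^+ m) j
              * coef (cls i * cls j) l == 0.
  move/eqP: s0; rewrite psumr_eq0 => [|i' _]; last first.
    by apply: sumr_ge0 => j' _; rewrite !mulr_ge0 ?coef_sigmaX_ge0 ?coef_ge0.
  move=> /allP/(_ i (mem_index_enum i)) /=; rewrite psumr_eq0 => [|j' _].
    by move=> /allP/(_ j (mem_index_enum j)).
  by rewrite !mulr_ge0 ?coef_sigmaX_ge0 ?coef_ge0.
rewrite big1 // => i _; rewrite big1 // => j _; apply/eqP.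
have := t0 i j; rewrite !mulf_eq0 -!orbA.
have [//|/hf/negPf ->] := eqVneq (coef f i) 0.
by have [//|/hg/negPf ->] := eqVneq (coef g j) 0.
Qed.

(* K_0 of the AF-algebra lim_n End(sigma^n) attached to [C] and [p] is the limit
   of the free groups on the simple summands of sigma^n, with multiplication by
   sigma as connecting maps; [(n, f)] is the element [f] of the [n]-th group. *)
Definition staged := {u : nat * C | in_stage u.1 u.2}.
HB.instance Definition _ := Choice.on staged.

Definition Staged n f (h : in_stage n f) : staged := exist _ (n, f) h.

Definition lim_eqv (u v : staged) : bool :=
  `[< exists i j, ((val u).1 + i = (val v).1 + j)%N
        /\ sigma ^+ i * (val u).2 = sigma ^+ j * (val v).2 >].

Lemma lim_eqv_equiv : equiv_class_of lim_eqv.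
Proof.
split=> [u | u v | v u w].
- by apply/asboolP; exists 0%N, 0%N.
- by apply/asboolP/asboolP => -[i [j [e1 e2]]]; exists j, i.
- move=> /asboolP[i [j [e1 e2]]] /asboolP[i' [j' [e3 e4]]]; apply/asboolP.
  exists (i + i')%N, (j + j')%N; split; first by lia.
  by rewrite [(i + i')%N]addnC !exprD -!mulrA e2 mulrCA e4.
Qed.

Canonical lim_eqv_rel := EquivRelPack lim_eqv_equiv.

Definition K0 := {eq_quot lim_eqv}.
HB.instance Definition _ := EqQuotient.on K0.
HB.instance Definition _ := Choice.on K0.

Definition K0_class n f (h : in_stage n f) : K0 := \pi_K0 (Staged h).

Lemma K0_classP n f (hf : in_stage n f) m g (hg : in_stage m g) :
  K0_class hf = K0_class hg <->
  exists i j, (n + i = m + j)%N /\ sigma ^+ i * f = sigma ^+ j * g.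
Proof.
split=> [/eqmodP/asboolP // | h].
by apply/eqmodP/asboolP.
Qed.

Lemma K0_eq n f (hf : in_stage n f) m g (hg : in_stage m g) :
  n = m -> f = g -> K0_class hf = K0_class hg.
Proof. by move=> e1 e2; apply/K0_classP; exists 0%N, 0%N; rewrite e1 e2. Qed.

Lemma K0_classW (P : K0 -> Prop) :
  (forall n f (h : in_stage n f), P (K0_class h)) -> forall u, P u.
Proof. by move=> h u; rewrite -[u]reprK; case: (repr u) => -[n f] /= hf; apply: h. Qed.

Definition lim_add_stage (u v : staged) :
    in_stage ((val u).1 + (val v).1)
      (sigma ^+ (val v).1 * (val u).2 + sigma ^+ (val u).1 * (val v).2) :=
  in_stageD
    (eq_ind_r (fun n => in_stage n (sigma ^+ (val v).1 * (val u).2))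
       (in_stageM (in_stage_sigmaX (val v).1) (valP u)) (addnC _ _))
    (in_stageM (in_stage_sigmaX (val u).1) (valP v)).

(* Representatives [(n, f)] and [(m, g)] are added after pushing both to stage
   [n + m], and multiplied by [(n, f) * (m, g) = (n + m, f * g)]; for [n = m]
   this product lies at stage [2 n]. *)
Definition K0_add (u v : K0) : K0 := K0_class (lim_add_stage (repr u) (repr v)).
Definition K0_opp (u : K0) : K0 := K0_class (in_stageN (valP (repr u))).
Definition K0_mul (u v : K0) : K0 :=
  K0_class (in_stageM (valP (repr u)) (valP (repr v))).
Definition K0_zero : K0 := K0_class (in_stage0 0).
Definition K0_one : K0 := K0_class (in_stage_sigmaX 0).

Let reprE n f (h : in_stage n f) :
  exists i j, ((val (repr (K0_class h))).1 + i = n + j)%N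
    /\ sigma ^+ i * (val (repr (K0_class h))).2 = sigma ^+ j * f.
Proof.
have : K0_class (valP (repr (K0_class h))) = K0_class h.
  rewrite -[RHS]reprK; congr (\pi_K0 _).
  by apply: val_inj; case: (repr _) => -[].
by move/K0_classP.
Qed.

Lemma K0_addE n f (hf : in_stage n f) m g (hg : in_stage m g) h :
  K0_add (K0_class hf) (K0_class hg) =
  @K0_class (n + m) (sigma ^+ m * f + sigma ^+ n * g) h.
Proof.
apply/K0_classP; have [i [j [e1 e2]]] := reprE hf.
have [i' [j' [e3 e4]]] := reprE hg.
move: e1 e2 e3 e4; set n' := (val _).1; set f' := (val _).2.
set m' := (val _).1; set g' := (val _).2 => e1 e2 e3 e4.
exists (i + i')%N, (j + j')%N; split; first by rewrite addnACA e1 e3 addnACA.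
rewrite !mulrDr; congr (_ + _).
  rewrite mulrA -exprD (_ : i + i' + m' = m + j' + i)%N; last by lia.
  rewrite exprD -mulrA e2 !mulrA -!exprD.
  by congr (_ ^+ _ * _); lia.
rewrite mulrA -exprD (_ : i + i' + n' = n + j + i')%N; last by lia.
rewrite exprD -mulrA e4 !mulrA -!exprD.
by congr (_ ^+ _ * _); lia.
Qed.

Lemma K0_oppE n f (hf : in_stage n f) h :
  K0_opp (K0_class hf) = @K0_class n (- f) h.
Proof.
apply/K0_classP; have [i [j [e1 e2]]] := reprE hf.
by exists i, j; split; rewrite // !mulrN e2.
Qed.

Lemma K0_mulE n f (hf : in_stage n f) m g (hg : in_stage m g) h :
  K0_mul (K0_class hf) (K0_class hg) = @K0_class (n + m) (f * g) h.
Proof.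
apply/K0_classP; have [i [j [e1 e2]]] := reprE hf.
have [i' [j' [e3 e4]]] := reprE hg.
exists (i + i')%N, (j + j')%N; split; first by rewrite addnACA e1 e3 addnACA.
by rewrite !exprD mulrACA e2 e4 mulrACA.
Qed.

Fact K0_addA : associative K0_add.
Proof.
elim/K0_classW=> n f hf; elim/K0_classW=> m g hg; elim/K0_classW=> q h hh.
have add n1 f1 m1 g1 (h1 : in_stage n1 f1) (h2 : in_stage m1 g1) :
    in_stage (n1 + m1) (sigma ^+ m1 * f1 + sigma ^+ n1 * g1).
  exact: (lim_add_stage (Staged h1) (Staged h2)).
rewrite (K0_addE hg hh (add _ _ _ _ hg hh)) (K0_addE hf hg (add _ _ _ _ hf hg)).
rewrite (K0_addE _ _ (add _ _ _ _ hf (add _ _ _ _ hg hh))).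
rewrite (K0_addE _ _ (add _ _ _ _ (add _ _ _ _ hf hg) hh)).
apply: K0_eq; first by rewrite addnA.
rewrite !mulrDr addrA !mulrA -!exprD.
by congr (_ ^+ _ * _ + _ ^+ _ * _ + _); lia.
Qed.

Fact K0_addC : commutative K0_add.
Proof.
elim/K0_classW=> n f hf; elim/K0_classW=> m g hg.
rewrite (K0_addE _ _ (lim_add_stage (Staged hf) (Staged hg))).
rewrite (K0_addE _ _ (lim_add_stage (Staged hg) (Staged hf))).
by apply: K0_eq; rewrite /= 1?addnC 1?addrC.
Qed.

Fact K0_add0 : left_id K0_zero K0_add.
Proof.
elim/K0_classW=> n f hf.
rewrite (K0_addE _ _ (lim_add_stage (Staged (in_stage0 0)) (Staged hf))).
by apply: K0_eq; rewrite //= mulr0 add0r mul1r.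
Qed.

Fact K0_addN : left_inverse K0_zero K0_opp K0_add.
Proof.
elim/K0_classW=> n f hf; rewrite (K0_oppE _ (in_stageN hf)).
rewrite (K0_addE _ _ (lim_add_stage (Staged (in_stageN hf)) (Staged hf))) /=.
apply/K0_classP; exists 0%N, (n + n)%N; split; first by rewrite addn0.
by rewrite mulr0 mul1r mulrN addNr.
Qed.

Fact K0_mulA : associative K0_mul.
Proof.
elim/K0_classW=> n f hf; elim/K0_classW=> m g hg; elim/K0_classW=> q h hh.
rewrite (K0_mulE hg hh (in_stageM hg hh)) (K0_mulE hf hg (in_stageM hf hg)).
rewrite (K0_mulE _ _ (in_stageM hf (in_stageM hg hh))).
rewrite (K0_mulE _ _ (in_stageM (in_stageM hf hg) hh)).
by apply: K0_eq; rewrite ?addnA ?mulrA.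
Qed.

Fact K0_mulC : commutative K0_mul.
Proof.
elim/K0_classW=> n f hf; elim/K0_classW=> m g hg.
rewrite (K0_mulE _ _ (in_stageM hf hg)) (K0_mulE _ _ (in_stageM hg hf)).
by apply: K0_eq; rewrite 1?addnC 1?mulrC.
Qed.

Fact K0_mul1 : left_id K0_one K0_mul.
Proof.
elim/K0_classW=> n f hf.
rewrite (K0_mulE _ _ (in_stageM (in_stage_sigmaX 0) hf)).
by apply: K0_eq; rewrite //= mul1r.
Qed.

Fact K0_mulD : left_distributive K0_mul K0_add.
Proof.
elim/K0_classW=> n f hf; elim/K0_classW=> m g hg; elim/K0_classW=> q h hh.
have hfg := lim_add_stage (Staged hf) (Staged hg).
rewrite (K0_addE _ _ hfg) (K0_mulE _ _ (in_stageM hfg hh)).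
have hfh := in_stageM hf hh; have hgh := in_stageM hg hh.
rewrite (K0_mulE _ _ hfh) (K0_mulE _ _ hgh).
rewrite (K0_addE _ _ (lim_add_stage (Staged hfh) (Staged hgh))) /=.
apply/K0_classP; exists q, 0%N; split; first by lia.
rewrite mul1r mulrDl mulrDr !mulrA -!exprD.
by congr (_ ^+ _ * _ * _ + _ ^+ _ * _ * _); lia.
Qed.

HB.instance Definition _ :=
  GRing.isZmodule.Build K0 K0_addA K0_addC K0_add0 K0_addN.
HB.instance Definition _ :=
  GRing.Zmodule_isComPzRing.Build K0 K0_mulA K0_mulC K0_mul1 K0_mulD.

Definition K0_pos : set K0 :=
  [set u | exists n f (h : in_stage n f),
     (forall i, 0 <= coef f i) /\ u = K0_class h].

End K0.

(* Weights are written in the basis of fundamental weights, with (1,0) the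
   highest short root and (0,1) the highest root. The simple roots are
   (2,-1) (short) and (-3,2) (long); the corresponding reflections are *)
Definition refl1 (w : int * int) : int * int := (- w.1, w.1 + w.2).
Definition refl2 (w : int * int) : int * int := (w.1 + 3 * w.2, - w.2).

(* Functions on the maximal torus, as rational functions of the two coordinates
   given by the fundamental weights. *)
Definition torus_fun : fieldType := {fraction {mpoly int[2]}}.

Definition frac_var (i : 'I_2) : torus_fun := tofrac 'X_i.

Definition expw (w : int * int) : torus_fun :=
  frac_var ord0 ^ w.1 * frac_var ord_max ^ w.2.

(* The Weyl group has order 12: it consists of the six rotations
   (refl1 refl2)^j and of the six reflections (refl1 refl2)^j refl1. *)
Definition weyl_num (w : int * int) : torus_fun :=
  \sum_(j < 6) (expw (iter j (refl1 \o refl2) w)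
                - expw (iter j (refl1 \o refl2) (refl1 w))).

(* Character of the irreducible representation with Dynkin labels [l], by the
   Weyl character formula; the half-sum of the positive roots is (1,1). *)
Definition irrep_char (l : nat * nat) : torus_fun :=
  weyl_num (l.1.+1%:Z, l.2.+1%:Z) / weyl_num (1, 1).

Definition eval2 (A : nzRingType) (a b : A) (q : {mpoly int[2]}) : A :=
  mmap intr (fun i : 'I_2 => if i == ord0 then a else b) q.

(* The polynomial Q_l: its value at the characters of the two fundamental
   representations is the character of the irreducible representation with
   Dynkin labels [l]. There is exactly one such polynomial. *)
Definition Qpoly (l : nat * nat) : {mpoly int[2]} :=
  xget 0 [set q | eval2 (irrep_char (1, 0)%N) (irrep_char (0, 1)%N) q
                  = irrep_char l].

Definition level (l : nat * nat) : nat := l.1 + 2 * l.2.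

(* The polynomial P_l: P_l(1/x, y/x^2) = x^{-(l_1 + 2 l_2)} Q_l(x, y) as Laurent
   polynomials. There is exactly one such polynomial. *)
Definition Ppoly (l : nat * nat) : {mpoly int[2]} :=
  let x := frac_var ord0 in let y := frac_var ord_max in
  xget 0 [set p | eval2 x^-1 (y / x ^+ 2) p
                  = x ^- level l * eval2 x y (Qpoly l)].

Definition boundary (k : nat) : set (nat * nat) :=
  [set l | level l = k.+1 \/ l = (k.+2, 0)%N].

(* Z[x,y]/J_k *)
Definition Ver (k : nat) := ring_quot (Qpoly @` boundary k).

(* Z[s,t]/I_k *)
Definition STring (k : nat) := ring_quot (Ppoly @` boundary k).

Definition STpos (R : realType) (k : nat) (b1 b2 : R) : set (STring k) :=
  [set ring_class _ p | p in [set p | 0 < eval2 b1 b2 p]] `|` [set 0].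

(* [C] is the fusion ring of Rep_k(G_2): the Verlinde ring, the simple object
   with label [l] being the class of [Qpoly l]. *)
Record RepG2 (k : nat) (C : fusion_ring) := {
  label : simple C -> nat * nat;
  label_inj : injective label;
  label_range : forall l, (exists i, label i = l) <-> (level l <= k)%N;
  verlinde : {rmorphism Ver k -> C};
  verlinde_bij : bijective verlinde;
  verlinde_Q : forall i, verlinde (ring_class _ (Qpoly (label i))) = cls i;
  self_conj : forall i : simple C, conj_obj i = i
}.

Definition quantum_dim (R : realType) (C : fusion_ring)
    (d : {rmorphism C -> R}) : Prop :=
  forall i : simple C, 0 < d (cls i).

(* Main.v *)
Require Import Defs.
From HB Require Import structures.
From mathcomp Require Import all_boot all_order all_algebra.
From mathcomp Require Import boolp classical_sets reals.
From mathcomp Require Import zify ring lra.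
From mathcomp Require Import mpoly.

(** Write x, y for the classes of pi_(1,0), pi_(0,1) in the fusion ring F and let
s, t be the variables of Z[s,t]. Since sigma = x^2, the limit K_0 maps to the
localization F[1/x] by (n, f) |-> f / x^(2n), and s = 1/x, t = y/x^2. Two facts
turn this into an isomorphism.

First, grade Z[x,y] by deg x = 1, deg y = 2. The relation
x Q_(a,b) = sum of Q_((a,b)+w) over the seven weights w of the 7-dimensional
representation (and its analogue for y) shows by induction that Q_(a,b) has
degree a + 2b and top-degree part y^b S_a(x,y), with S_(n+2) = x S_(n+1) - y S_n.
Hence P_(a,b) is a polynomial, and P_(k+1,0), P_(k+2,0) reduce modulo s to two
consecutive terms S_(k+1)(1,t), S_(k+2)(1,t), which generate the unit ideal of
Z[t]. So s is invertible modulo I_k, and Z[s,t]/I_k = F[1/x].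

Second, x^2 = 1 + x + y + Q_(2,0) contains 1, x and y, which generate F, so some
power of sigma contains every simple object; hence K_0 is all of F[1/x].

Under this identification evaluation at (beta_1, beta_2) is f / x^(2n) |->
d(f) / d(x)^(2n), and the description of the positive cone is the
Perron-Frobenius statement that d(f) > 0 forces sigma^n f >= 0 for some n. *)

Set Implicit Arguments.
Unset Strict Implicit.
Unset Printing Implicit Defensive.

Import Order.TTheory GRing.Theory Num.Theory.

Local Open Scope classical_set_scope.
Local Open Scope quotient_scope.
Local Open Scope ring_scope.

Local Notation ZP := {mpoly int[2]}.
Local Notation X0 := (@mpolyX 2 int (mnm1 ord0)).
Local Notation X1 := (@mpolyX 2 int (mnm1 ord_max)).
Local Notation weight := (int * int)%type.
Local Notation rot := (refl1 \o refl2).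

(** * Polynomials in two variables *)

Lemma ZP_expand (q : ZP) :
  q = \sum_(m <- msupp q) X0 ^+ m ord0 * X1 ^+ m ord_max *~ q@_m.
Proof.
rewrite {1}[q]mpolyE; apply: eq_bigr => m _.
rewrite mpolyXE_id big_ord_recl big_ord1 -mul_mpolyC.
rewrite (_ : lift ord0 ord0 = ord_max); last exact: val_inj.
rewrite -[q@_m in LHS]intz rmorph_int mulrzl //.
Qed.

Lemma ZP_morphE (A : comPzRingType) (f : {rmorphism ZP -> A}) (q : ZP) :
  f q = \sum_(m <- msupp q) f X0 ^+ m ord0 * f X1 ^+ m ord_max *~ q@_m.
Proof.
rewrite {1}(ZP_expand q) rmorph_sum; apply: eq_bigr => m _.
by rewrite rmorphMz rmorphM !rmorphXn.
Qed.

Lemma ZP_morph_eq (A : comPzRingType) (f g : {rmorphism ZP -> A}) :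
  f X0 = g X0 -> f X1 = g X1 -> f =1 g.
Proof. by move=> e0 e1 q; rewrite (ZP_morphE f q) (ZP_morphE g q) e0 e1. Qed.

Section Eval2.
Variables (A : comNzRingType) (a b : A).

Fact eval2_is_zmod_morphism : zmod_morphism (eval2 a b).
Proof. exact: mmap_is_additive. Qed.
Fact eval2_is_monoid_morphism : monoid_morphism (eval2 a b).
Proof.
by have [] := mmap_is_multiplicative
  (fun i : 'I_2 => if i == ord0 then a else b) (intr : int -> A).
Qed.
HB.instance Definition _ :=
  GRing.isZmodMorphism.Build ZP A (eval2 a b) eval2_is_zmod_morphism.
HB.instance Definition _ :=
  GRing.isMonoidMorphism.Build ZP A (eval2 a b) eval2_is_monoid_morphism.

Lemma eval2X0 : eval2 a b X0 = a.
Proof. by rewrite /eval2 mmapX mmap1U. Qed.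
Lemma eval2X1 : eval2 a b X1 = b.
Proof. by rewrite /eval2 mmapX mmap1U. Qed.
End Eval2.

(** [eval2] needs a target with 1 != 0, which is not known in advance for [STring k]; the zero ring
    therefore gets its own case. *)
Lemma exists_ZP_morph (A : comPzRingType) (a b : A) :
  exists f : {rmorphism ZP -> A}, f X0 = a /\ f X1 = b.
Proof.
have [e|e] := pselect (1 = 0 :> A).
  have A0 (u : A) : u = 0 by rewrite -[u]mulr1 e mulr0.
  pose f (_ : ZP) : A := 0.
  have fB : zmod_morphism f by move=> u v; rewrite /f subr0.
  have fM : monoid_morphism f by split=> [|u v]; rewrite /f ?mulr0.
  pose fa := GRing.isZmodMorphism.Build ZP A f fB.
  pose fm := GRing.isMonoidMorphism.Build ZP A f fM.
  pose F : {rmorphism ZP -> A} := HB.pack f fa fm.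
  by exists F; rewrite (A0 a) (A0 b).
have nz : 1 != 0 :> A by apply/eqP.
pose nzA := GRing.PzSemiRing_isNonZero.Build A nz.
pose A' : comNzRingType := HB.pack (GRing.ComPzRing.sort A) nzA.
exists (eval2 (a : A') (b : A') : {rmorphism ZP -> A'}).
by split; [apply: (@eval2X0 A') | apply: (@eval2X1 A')].
Qed.

(* [p(1/x, y/x^2) = x^(-L) q(x, y)]: with [f] evaluating at [(x, y)] and [g] at
   [(s, t)], the hypotheses say [s = 1/x] and [t = y/x^2]. *)
Definition homogenizes (L : nat) (q p : ZP) : Prop :=
  forall (A : comPzRingType) (f g : {rmorphism ZP -> A}),
    g X0 * f X0 = 1 -> g X1 = f X1 * g X0 ^+ 2 -> g p = g X0 ^+ L * f q.

Lemma homogD L q p q' p' :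
  homogenizes L q p -> homogenizes L q' p' -> homogenizes L (q + q') (p + p').
Proof. by move=> h h' A f g e0 e1; rewrite !rmorphD mulrDr (h A f) // (h' A f). Qed.

Lemma homogN L q p : homogenizes L q p -> homogenizes L (- q) (- p).
Proof. by move=> h A f g e0 e1; rewrite !rmorphN mulrN (h A f). Qed.

(** Raising the degree bound for the same [q] costs a factor s: lower-degree terms vanish modulo
    s. *)
Lemma homog_raise L q p : homogenizes L q p -> homogenizes L.+1 q (X0 * p).
Proof. by move=> h A f g e0 e1; rewrite rmorphM (h A f) // exprS mulrA. Qed.

(** The new factors s and x cancel, so [p] stays the same. *)
Lemma homogX0 L q p : homogenizes L q p -> homogenizes L.+1 (X0 * q) p.
Proof.
by move=> h A f g e0 e1; rewrite (h A f) // rmorphM exprSr -mulrA [g X0 * _]mulrA e0 mul1r.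
Qed.

Lemma homogX1 L q p : homogenizes L q p -> homogenizes L.+2 (X1 * q) (X1 * p).
Proof.
move=> h A f g e0 e1; rewrite !rmorphM (h A f) // e1 -(addn2 L) exprD.
by rewrite mulrACA [in RHS]mulrACA [f X1 * _]mulrC.
Qed.

Lemma homog0 : homogenizes 0 0 0.
Proof. by move=> A f g _ _; rewrite !rmorph0 mulr0. Qed.

Lemma homog1 : homogenizes 0 1 1.
Proof. by move=> A f g _ _; rewrite !rmorph1 mulr1. Qed.

(* The specialisations give distinct degrees to the cleared monomials
   [A^i B^j D^(N-i-j)], so the term of highest degree cannot cancel. *)
Lemma alg_indep (A B D : ZP) : D != 0 ->
  (forall N : nat, exists (phi : {rmorphism ZP -> {poly int}}) (a b c : nat),
     [/\ phi A \is monic /\ size (phi A) = a.+1,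
         phi B \is monic /\ size (phi B) = b.+1,
         phi D \is monic /\ size (phi D) = c.+1
       & forall i j i' j', (i + j < N)%N -> (i' + j' < N)%N ->
          (a * i + b * j + c * (N - (i + j)) =
           a * i' + b * j' + c * (N - (i' + j')))%N -> i = i' /\ j = j']) ->
  forall q, eval2 (tofrac A / tofrac D) (tofrac B / tofrac D) q = 0 -> q = 0.
Proof.
move=> D0 spec q q0; apply/eqP/negPn/negP => nzq.
have [phi [a [b [c [[mA sA] [mB sB] [mD sD] inj]]]]] := spec (msize q).
set N := msize q in inj.
have mdegE2 (m : 'X_{1..2}) : (m ord0 + m ord_max)%N = mdeg m.
  rewrite mdegE big_ord_recl big_ord1; congr (_ + m _)%N; exact: val_inj.
have ltN (m : 'X_{1..2}) : m \in msupp q -> (m ord0 + m ord_max < N)%N.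
  by rewrite mdegE2 => /msize_mdeg_lt.
(* Multiplication by [D ^+ N] clears all denominators, since [N = msize q] exceeds every total
   degree in [q]. *)
pose mon (m : 'X_{1..2}) :=
  A ^+ m ord0 * B ^+ m ord_max * D ^+ (N - (m ord0 + m ord_max)).
have T0 : \sum_(m <- msupp q) mon m *~ q@_m = 0.
  apply/eqP; rewrite -tofrac_eq0; apply/eqP.
  rewrite -[RHS](mulr0 (tofrac D ^+ N)) -q0 (ZP_morphE (eval2 _ _)) mulr_sumr.
  rewrite rmorph_sum; apply: eq_big_seq => m /ltN lt.
  rewrite rmorphMz /= eval2X0 eval2X1 mulrzAr; congr (_ *~ _).
  rewrite !rmorphM !rmorphXn !expr_div_n.
  have D0' : tofrac D != 0 by rewrite tofrac_eq0.
  have -> : tofrac D ^+ N = tofrac D ^+ (N - (m ord0 + m ord_max))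
      * tofrac D ^+ m ord0 * tofrac D ^+ m ord_max.
    by rewrite -!exprD; congr (_ ^+ _); lia.
  have cancelD (K : fieldType) (u v w z x : K) : w != 0 -> z != 0 ->
      u * v * x = x * w * z * (u / w * (v / z)).
    by move=> w0 z0; field; rewrite w0 z0.
  by apply: cancelD; rewrite expf_neq0.
pose e (m : 'X_{1..2}) := (a * m ord0 + b * m ord_max
  + c * (N - (m ord0 + m ord_max)))%N.
have smon m : phi (mon m) \is monic /\ size (phi (mon m)) = (e m).+1.
  rewrite !rmorphM !rmorphXn /=.
  have mX (p : {poly int}) n k : p \is monic /\ size p = n.+1 ->
    p ^+ k \is monic /\ size (p ^+ k) = (n * k).+1.
    move=> [mp sp]; split; first exact: monic_exp.
    by rewrite -[LHS]prednK ?size_exp ?sp // size_poly_gt0 monic_neq0 ?monic_exp.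
  have [mA' sA'] := mX _ _ (m ord0) (conj mA sA).
  have [mB' sB'] := mX _ _ (m ord_max) (conj mB sB).
  have [mD' sD'] := mX _ _ (N - (m ord0 + m ord_max))%N (conj mD sD).
  split; first by rewrite !monicMl.
  rewrite size_mul ?monic_neq0 ?monicMl // size_mul ?monic_neq0 //.
  by rewrite sA' sB' sD' /e !addnS /= addSn.
have nnil : msupp q != [::] by rewrite msupp_eq0.
have [m0 m0P] : exists m, m \in msupp q.
  by case: (msupp q) nnil => // m s _; exists m; rewrite mem_head.
case: (@arg_maxnP _ (SeqSub m0P) predT (fun i => e (val i)) isT) => -[m1 m1P] _ /= m1max.
(* The coefficient at the largest exponent [e m1] comes from [m1] alone: by [inj] all other terms
   have strictly smaller degree. *)
have := congr1 (fun p : {poly int} => p`_(e m1)) (congr1 phi T0).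
rewrite rmorph0 coef0 rmorph_sum coef_sum (big_rem m1) //= big_seq big1 ?addr0.
  rewrite rmorphMz coefMrz; have [mm sm] := smon m1.
  have -> : (phi (mon m1))`_(e m1) = 1 by move/monicP: mm; rewrite lead_coefE sm.
  by apply/eqP; rewrite intz -mcoeff_msupp.
move=> m; rewrite mem_rem_uniq ?msupp_uniq // inE => /andP[nm1 mP].
rewrite rmorphMz coefMrz; have [mm sm] := smon m.
rewrite nth_default ?mul0rz // sm ltn_neqAle.
apply/andP; split; last exact: (m1max (SeqSub mP) isT).
apply: contra nm1 => /eqP /inj; rewrite !ltN // => -[] // e0 e1.
apply/eqP/mnmP => i; case: (unliftP ord0 i) => [j ->|-> //].
by rewrite ord1 (_ : lift ord0 ord0 = ord_max) //; apply: val_inj.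
Qed.

Lemma size_sum_Xn n (s : seq nat) :
  all (fun i => i < n)%N s -> (size (\sum_(i <- s) 'X^i : {poly int})%R <= n)%N.
Proof.
elim: s => [|i s IH] /=; first by rewrite big_nil size_poly0.
case/andP=> lt /IH le; rewrite big_cons (leq_trans (size_polyD _ _)) //.
by rewrite geq_max size_polyXn lt le.
Qed.

Lemma monic_sum_Xn n (s : seq nat) :
  all (fun i => i < n)%N s ->
  let p := \sum_(i <- n :: s) ('X^i : {poly int}) in
  p \is monic /\ size p = n.+1.
Proof.
move=> /size_sum_Xn h /=; rewrite big_cons.
have lt : (size (\sum_(i <- s) 'X^i : {poly int})%R < size ('X^n : {poly int})%R)%N.
  by rewrite size_polyXn.
split; last by rewrite size_polyDl ?size_polyXn.
by rewrite monicE lead_coefDl // lead_coefXn.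
Qed.

(** * Characters of G_2 *)

Lemma ZPX_neq0 i : (@mpolyX 2 int (mnm1 i)) != 0.
Proof.
apply/eqP => /(congr1 (fun p : ZP => p@_(mnm1 i)%MM)).
by rewrite mcoeffX eqxx mcoeff0.
Qed.

Lemma frac_var_neq0 i : frac_var i != 0.
Proof. by rewrite /frac_var tofrac_eq0 ZPX_neq0. Qed.

Lemma expwD (v w : weight) : expw (v + w) = expw v * expw w.
Proof. by rewrite /expw !expfzDr ?frac_var_neq0 // mulrACA. Qed.

(** Numerator of [expw v] over [X0 ^+ a * X1 ^+ b]; the absolute values only convert nonnegative
    shifted exponents to [nat]. *)
Definition clear_denom (a b : nat) (v : weight) : ZP :=
  X0 ^+ `|a%:Z + v.1| * X1 ^+ `|b%:Z + v.2|.

Lemma eval2_sum_clear_denom (A : comNzRingType) (x y : A) a b s :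
  eval2 x y (\sum_(v <- s) clear_denom a b v) =
  \sum_(v <- s) x ^+ `|a%:Z + v.1| * y ^+ `|b%:Z + v.2|.
Proof.
rewrite rmorph_sum; apply: eq_bigr => v _.
by rewrite rmorphM !rmorphXn /= eval2X0 eval2X1.
Qed.

Lemma sum_expw_frac (a b : nat) (s : seq weight) :
  all (fun v : weight => (0 <= a%:Z + v.1) && (0 <= b%:Z + v.2)) s ->
  \sum_(v <- s) expw v = tofrac (\sum_(v <- s) clear_denom a b v)
                          / tofrac (X0 ^+ a * X1 ^+ b).
Proof.
move=> /allP s0; rewrite rmorph_sum mulr_suml; apply: eq_big_seq => -[v1 v2] /s0 /=.
case/andP=> h1 h2; rewrite /expw /clear_denom /= !rmorphM !rmorphXn /= -!/(frac_var _).
have E (i : 'I_2) (n : nat) (z : int) : 0 <= n%:Z + z ->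
    frac_var i ^ z = frac_var i ^+ `|n%:Z + z| / frac_var i ^+ n.
  move=> nz; apply: (canRL (mulfK _)); first by rewrite expf_neq0 ?frac_var_neq0.
  by rewrite !exprnP -expfzDr ?frac_var_neq0 // gez0_abs // addrC.
by rewrite (E ord0 a) // (E ord_max b) // invfM mulrACA.
Qed.

(** * The Weyl group and Brauer's formula *)

Lemma refl1D : {morph refl1 : v w / v + w}.
Proof. by move=> [v1 v2] [w1 w2]; congr pair => /=; lia. Qed.
Lemma refl2D : {morph refl2 : v w / v + w}.
Proof. by move=> [v1 v2] [w1 w2]; congr pair => /=; lia. Qed.
Lemma refl1K : involutive refl1.
Proof. by move=> [v1 v2]; rewrite /refl1 /=; congr pair; lia. Qed.
Lemma refl2K : involutive refl2.
Proof. by move=> [v1 v2]; rewrite /refl2 /=; congr pair; lia. Qed.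
(** [rot] is a Coxeter element of order six, so its cube is the central element -1. *)
Lemma rot3 w : rot (rot (rot w)) = - w.
Proof. by case: w => w1 w2; rewrite /= /refl1 /refl2 /=; congr pair; ring. Qed.

Definition rot_sum (w : weight) : torus_fun := \sum_(j < 6) expw (iter j rot w).

Lemma weyl_numE w : weyl_num w = rot_sum w - rot_sum (refl1 w).
Proof. by rewrite /weyl_num sumrB. Qed.

Lemma rot_sum_rot w : rot_sum (rot w) = rot_sum w.
Proof.
rewrite /rot_sum [RHS]big_ord_recl [LHS]big_ord_recr /= [RHS]addrC; congr (_ + _).
  by apply: eq_bigr => j _; rewrite -iterSr.
congr expw; transitivity (rot (rot (rot (rot (rot (rot w)))))) => //.
by rewrite (rot3 (rot (rot (rot w)))) rot3 opprK.
Qed.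

(** The two reflections differ by a rotation, hence lie in one coset of the rotation subgroup. *)
Lemma rot_sum_refl2 w : rot_sum (refl2 w) = rot_sum (refl1 w).
Proof. by rewrite -rot_sum_rot /= refl2K. Qed.

Lemma weyl_num_refl1 w : weyl_num (refl1 w) = - weyl_num w.
Proof. by rewrite !weyl_numE refl1K opprB. Qed.

Lemma weyl_num_refl2 w : weyl_num (refl2 w) = - weyl_num w.
Proof.
by rewrite !weyl_numE rot_sum_refl2 -(rot_sum_rot w) opprB.
Qed.

Lemma weyl_num_wall1 w : refl1 w = w -> weyl_num w = 0.
Proof. by move=> e; rewrite weyl_numE e subrr. Qed.

Lemma weyl_num_wall2 w : refl2 w = w -> weyl_num w = 0.
Proof. by move=> e; rewrite weyl_numE -rot_sum_refl2 e subrr. Qed.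

(** Since [s] is stable under rotation, in each summand [v] may be rotated along with [w]. *)
Lemma rot_sum_mul (s : seq weight) w : perm_eq (map rot s) s ->
  (\sum_(v <- s) expw v) * rot_sum w = \sum_(v <- s) rot_sum (v + w).
Proof.
move=> ps; rewrite exchange_big mulr_sumr; apply: eq_bigr => j _.
have iD : {morph iter j rot : v w / v + w}.
  by move=> v u; elim: (val j) => [|n IH] //; rewrite !iterS IH /= refl2D refl1D.
have pj : perm_eq (map (iter j rot) s) s.
  elim: (val j) => [|n IH]; first by rewrite (eq_map (_ : _ =1 id)) ?map_id.
  rewrite (eq_map (_ : _ =1 rot \o iter n rot)) // map_comp.
  exact: perm_trans (perm_map _ IH) ps.
rewrite -(perm_big _ pj) big_map mulr_suml; apply: eq_bigr => v _.
by rewrite iD expwD.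
Qed.

(* Brauer's formula: a W-invariant multiset of weights acts on Weyl numerators
   by translation. *)
Lemma weyl_num_mul (s : seq weight) w :
  perm_eq (map refl1 s) s -> perm_eq (map refl2 s) s ->
  (\sum_(v <- s) expw v) * weyl_num w = \sum_(v <- s) weyl_num (v + w).
Proof.
move=> p1 p2.
have pr : perm_eq (map rot s) s.
  by rewrite map_comp; exact: perm_trans (perm_map _ p2) p1.
rewrite weyl_numE mulrBr !rot_sum_mul //.
rewrite -[X in _ - X](perm_big _ p1) big_map -sumrB.
by apply: eq_bigr => v _; rewrite weyl_numE refl1D.
Qed.

(** * Characters of the fundamental representations *)

Definition wts7 : seq weight :=
  [:: (1, 0); (-1, 1); (2, -1); (0, 0); (-2, 1); (1, -1); (-1, 0)].

(** The twelve roots and zero twice, the weights of the adjoint representation; [wts7] consists of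
    the six short roots and zero. *)
Definition wts14 : seq weight :=
  [:: (0, 1); (0, 0); (0, 0); (1, 0); (-1, 1); (2, -1); (-2, 1); (1, -1);
      (-1, 0); (0, -1); (3, -1); (-3, 1); (-3, 2); (3, -2)].

Definition char7 : torus_fun := \sum_(v <- wts7) expw v.
Definition char14 : torus_fun := \sum_(v <- wts14) expw v.

Lemma weyl_num_rho : weyl_num (1, 1) != 0.
Proof.
have rot_sumE w : rot_sum w = \sum_(v <- traject rot w 6) expw v.
  rewrite /rot_sum [RHS](big_nth w) size_traject big_mkord.
  by apply: eq_bigr => j _; rewrite nth_traject.
(* The coordinates of the orbit of (1,1) are at least -5 and -3, so [X0 ^+ 5 * X1 ^+ 3] clears
   denominators; a single integer point where the numerator is nonzero then suffices. *)
rewrite weyl_numE !rot_sumE !(@sum_expw_frac 5 3) // -mulrBl -rmorphB.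
rewrite mulf_neq0 ?invr_eq0 ?tofrac_eq0 ?mulf_neq0 ?expf_neq0 ?ZPX_neq0 //.
apply/eqP => /(congr1 (eval2 (- 1) (2 : int))).
rewrite rmorphB rmorph0 /= !eval2_sum_clear_denom.
by rewrite unlock; vm_compute.
Qed.

(** The Weyl quotient for arbitrary weights, because Brauer's formula leaves the dominant chamber.
    Reflections shifted by (1,1) change its sign. *)
Definition wchar (l : weight) : torus_fun := weyl_num (l + (1, 1)) / weyl_num (1, 1).

Lemma irrep_charE l : irrep_char l = wchar (l.1%:Z, l.2%:Z).
Proof. by rewrite /irrep_char /wchar; congr (weyl_num (_, _) / _) => /=; lia. Qed.

Lemma wchar00 : wchar (0, 0) = 1.
Proof. by rewrite /wchar divff ?weyl_num_rho. Qed.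

Lemma wchar_wall1 b : wchar (-1, b) = 0.
Proof.
rewrite /wchar weyl_num_wall1 ?mul0r //.
by rewrite /refl1 /=; congr pair => /=; lia.
Qed.

Lemma wchar_wall2 a : wchar (a, -1) = 0.
Proof.
rewrite /wchar weyl_num_wall2 ?mul0r //.
by rewrite /refl2 /=; congr pair => /=; lia.
Qed.

Lemma wchar_refl1 a b : wchar (a, b) = - wchar (- a - 2, a + b + 1).
Proof.
rewrite /wchar -mulNr -weyl_num_refl1; congr (weyl_num _ / _).
by rewrite /refl1 /=; congr pair => /=; lia.
Qed.

Lemma wchar_refl2 a b : wchar (a, b) = - wchar (a + 3 * b + 3, - b - 2).
Proof.
rewrite /wchar -mulNr -weyl_num_refl2; congr (weyl_num _ / _).
by rewrite /refl2 /=; congr pair => /=; lia.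
Qed.

Lemma wchar_mul7 a b :
  char7 * wchar (a, b) =
  wchar (a + 1, b) + (wchar (a - 1, b + 1) + (wchar (a + 2, b - 1)
  + (wchar (a, b) + (wchar (a - 2, b + 1) + (wchar (a + 1, b - 1)
  + wchar (a - 1, b)))))).
Proof.
rewrite {1}/wchar mulrA weyl_num_mul // mulr_suml !big_cons big_nil addr0.
by do !congr (_ + _); congr (weyl_num (_, _) / _) => /=; lia.
Qed.

Lemma wchar_mul14 a b :
  char14 * wchar (a, b) =
  wchar (a, b + 1) + (wchar (a, b) + (wchar (a, b) + (wchar (a + 1, b)
  + (wchar (a - 1, b + 1) + (wchar (a + 2, b - 1) + (wchar (a - 2, b + 1)
  + (wchar (a + 1, b - 1) + (wchar (a - 1, b) + (wchar (a, b - 1)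
  + (wchar (a + 3, b - 1) + (wchar (a - 3, b + 1) + (wchar (a - 3, b + 2)
  + wchar (a + 3, b - 2))))))))))))).
Proof.
rewrite {1}/wchar mulrA weyl_num_mul // mulr_suml !big_cons big_nil addr0.
by do !congr (_ + _); congr (weyl_num (_, _) / _) => /=; lia.
Qed.

(** In the product with the trivial character, terms on walls vanish and (-2,1) reflects to minus
    (0,0), cancelling the zero weight. *)
Lemma wchar10 : wchar (1, 0) = char7.
Proof.
have := wchar_mul7 0 0; rewrite /= wchar00 mulr1 => ->.
rewrite !wchar_wall1 !wchar_wall2 [wchar (-2, _)]wchar_refl1 wchar00.
by rewrite !add0r !addr0 subrr addr0.
Qed.

(** The terms (-2,1) and (3,-2) cancel the two zero weights, (-3,2) cancels (1,0), and the rest lies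
    on walls. *)
Lemma wchar01 : wchar (0, 1) = char14.
Proof.
have := wchar_mul14 0 0; rewrite /= wchar00 mulr1 => ->.
rewrite !wchar_wall1 !wchar_wall2 [wchar (-2, _)]wchar_refl1 wchar00.
rewrite [wchar (-3, 1)]wchar_refl1 [wchar (-3, 2)]wchar_refl1 wchar_wall2.
rewrite [wchar (3, -2)]wchar_refl2 wchar00 wchar10; ring.
Qed.

Lemma wchar20 : wchar (2, 0) = char7 ^+ 2 - char7 - char14 - 1.
Proof.
have := wchar_mul7 1 0; rewrite /= wchar10 -expr2 => ->.
by rewrite !wchar_wall2 wchar00 wchar_wall1 wchar01; ring.
Qed.

(** * Algebraic independence *)

Lemma char_alg_indep q : eval2 char7 char14 q = 0 -> q = 0.
Proof.
rewrite /char7 /char14 !(@sum_expw_frac 3 2) //; apply: alg_indep.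
  by rewrite mulf_neq0 ?expf_neq0 ?ZPX_neq0.
move=> N; pose M := N.+1.
(* The functional (5,8) makes (1,0) and (0,1) the unique leading weights of [wts7] and [wts14]. The
   extra 1 in [r] lets the residue modulo [M] reveal the exponent of [char14]. *)
pose p := (5 * M)%N; pose r := (8 * M + 1)%N.
pose f (v : weight) := (p * absz (Posz 3 + v.1)%R + r * absz (Posz 2 + v.2)%R)%N.
have E s : eval2 ('X^p : {poly int}) 'X^r (\sum_(v <- s) clear_denom 3 2 v)
    = \sum_(i <- map f s) 'X^i.
  rewrite eval2_sum_clear_denom big_map; apply: eq_bigr => v _.
  by rewrite -!exprM -exprD.
exists (eval2 ('X^p : {poly int}) 'X^r).
exists (4 * p + 2 * r)%N, (3 * p + 3 * r)%N, (3 * p + 2 * r)%N.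
split.
- rewrite /= E /=.
  have -> : (4 * p + 2 * r = f (Posz 1, Posz 0))%N by rewrite /f /= mulnC [(r * _)%N]mulnC.
  by apply: monic_sum_Xn; rewrite /= /f /p /r /M /=; lia.
- rewrite /= E /=.
  have -> : (3 * p + 3 * r = f (Posz 0, Posz 1))%N by rewrite /f /= mulnC [(r * _)%N]mulnC.
  by apply: monic_sum_Xn; rewrite /= /f /p /r /M /=; lia.
- rewrite rmorphM !rmorphXn /= eval2X0 eval2X1 -!exprM -exprD.
  rewrite mulnC [(r * 2)%N]mulnC.
  by rewrite monicXn size_polyXn.
have deg u v : (u + v < N -> (4 * p + 2 * r) * u + (3 * p + 3 * r) * v
    + (3 * p + 2 * r) * (N - (u + v))
    = (5 * u + 8 * v) * M + v + (3 * p + 2 * r) * N)%N.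
  by move=> /ltnW/subnKC; move: (N - _)%N => w <-; rewrite /p /r; ring.
move=> i j i' j' lt lt'; rewrite !deg // => /addIn e.
have ej : j = j'.
  by have := congr1 (modn^~ M) e; rewrite !modnMDl !modn_small //; rewrite /M; lia.
split=> //; move: e; rewrite ej => /eqP; rewrite eqn_add2r eqn_pmul2r //; lia.
Qed.

Lemma st_alg_indep (x := frac_var ord0) (y := frac_var ord_max) q :
  eval2 x^-1 (y / x ^+ 2) q = 0 -> q = 0.
Proof.
have x0 : x != 0 := frac_var_neq0 _.
have -> : x^-1 = tofrac X0 / tofrac (X0 ^+ 2).
  by rewrite rmorphXn /= expr2 invfM mulrA divff ?mul1r.
have -> : y / x ^+ 2 = tofrac X1 / tofrac (X0 ^+ 2) by rewrite rmorphXn.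
apply: alg_indep.
  by rewrite expf_neq0 ?ZPX_neq0.
move=> N; pose M := N.+1.
exists (eval2 ('X^M : {poly int}) 'X^(2 * M + 1)).
exists M, (2 * M + 1)%N, (2 * M)%N.
rewrite rmorphXn /= eval2X0 eval2X1 -exprM (mulnC M).
have deg u v : (M * u + (2 * M + 1) * v + 2 * M * (N - (u + v))
    = (u + 2 * v + 2 * (N - (u + v))) * M + v)%N by ring.
rewrite !monicXn !size_polyXn; split=> // i j i' j' lt lt'; rewrite !deg => e.
have ej : j = j'.
  by have := congr1 (modn^~ M) e; rewrite !modnMDl !modn_small //; rewrite /M; lia.
split=> //; move: e; rewrite ej => /eqP; rewrite eqn_add2r eqn_pmul2r //; lia.
Qed.

(** * The polynomials Q and P and their top-degree parts *)

Lemma QpolyE l q : eval2 char7 char14 q = irrep_char l -> Qpoly l = q.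
Proof.
move=> eq; apply/eqP; rewrite -subr_eq0; apply/eqP/char_alg_indep.
rewrite rmorphB /= eq; apply/eqP; rewrite subr_eq0; apply/eqP.
have := xgetPex 0 (ex_intro (fun q => eval2 (irrep_char (1, 0)%N)
  (irrep_char (0, 1)%N) q = irrep_char l) q _).
by rewrite /Qpoly /= !irrep_charE wchar10 wchar01; apply; rewrite eq irrep_charE.
Qed.

(** Independence of 1/x and y/x^2 leaves one candidate for [xget], as independence of the
    fundamental characters does for [Qpoly]. *)
Lemma PpolyE l p : homogenizes (level l) (Qpoly l) p -> Ppoly l = p.
Proof.
move=> hp; set x := frac_var ord0; set y := frac_var ord_max.
have x0 : x != 0 := frac_var_neq0 _.
have ep : eval2 x^-1 (y / x ^+ 2) p = x ^- level l * eval2 x y (Qpoly l).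
  rewrite (hp _ (eval2 x y) (eval2 x^-1 (y / x ^+ 2))) /= ?eval2X0 ?eval2X1 ?exprVn //.
  by rewrite mulVf.
apply/eqP; rewrite -subr_eq0; apply/eqP/st_alg_indep.
rewrite rmorphB /= ep; apply/eqP; rewrite subr_eq0; apply/eqP.
exact: (xgetPex 0 (ex_intro (fun p => eval2 x^-1 (y / x ^+ 2) p
  = x ^- level l * eval2 x y (Qpoly l)) p ep)).
Qed.

(* [S_n(1, t)], where [S_n(x, y)] is the top-degree part of [Q_(n,0)]. *)
Fixpoint top_poly (n : nat) : ZP :=
  if n is n'.+1 then
    if n' is n''.+1 then top_poly n' - X1 * top_poly n'' else 1
  else 1.

Lemma top_polySS n : top_poly n.+2 = top_poly n.+1 - X1 * top_poly n.
Proof. by []. Qed.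

(** Induction: the recurrence puts t S_n in the ideal of S_(n+1) and S_(n+2), and t is a unit modulo
    S_(n+1) because S_(n+1) = 1 modulo t. *)
Lemma top_poly_bezout n :
  exists a b, a * top_poly n + b * top_poly n.+1 = 1.
Proof.
have mod1 m : exists w, top_poly m = 1 + X1 * w.
  elim/ltn_ind: m => -[|[|m]] IH.
  - by exists 0; rewrite mulr0 addr0.
  - by exists 0; rewrite mulr0 addr0.
  have [w e] := IH m.+1 (leqnn _).
  by exists (w - top_poly m); rewrite top_polySS e; ring.
elim: n => [|n [a [b e]]]; first by exists 1, 0; rewrite mulr1 mul0r addr0.
have [w ew] := mod1 n.+1.
exists (a * (top_poly n - w) + b), (a * w).
rewrite top_polySS -[RHS]e.
transitivity (a * (top_poly n * (top_poly n.+1 - X1 * w)) + b * top_poly n.+1).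
  by ring.
by rewrite {1}ew addrK mulr1.
Qed.

(* [c] is a polynomial of degree at most [L] in the fundamental characters, and
   [p0] represents modulo [s] its homogenization, i.e. its part of degree [L]. *)
Definition graded_char (L : nat) (c : torus_fun) (p0 : ZP) : Prop :=
  exists q p r, [/\ eval2 char7 char14 q = c, homogenizes L q p
                  & p = p0 + X0 * r].

Lemma graded_charB L c p0 c' p0' :
  graded_char L c p0 -> graded_char L c' p0' ->
  graded_char L (c - c') (p0 - p0').
Proof.
move=> [q [p [r [e h s]]]] [q' [p' [r' [e' h' s']]]].
exists (q - q'), (p - p'), (r - r'); split.
- by rewrite rmorphB /= e e'.
- exact: homogD h (homogN h').
- by rewrite s s'; ring.
Qed.

Lemma graded_char_raise L c p0 : graded_char L c p0 -> graded_char L.+1 c 0.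
Proof.
move=> [q [p [r [e h s]]]]; exists q, (X0 * p), p; split=> //.
  exact: homog_raise.
by rewrite add0r.
Qed.

Lemma graded_char_lower L M c p0 :
  (L < M)%N -> graded_char L c p0 -> graded_char M c 0.
Proof.
move=> /subnKC <- h; elim: (M - L.+1)%N => [|n IH].
  by rewrite addn0; apply: graded_char_raise h.
by rewrite addnS; apply: graded_char_raise IH.
Qed.

Lemma graded_char0 L : graded_char L 0 0.
Proof.
suff h : graded_char 0 0 0.
  by case: L => [|L] //; apply: graded_char_lower h.
by exists 0, 0, 0; split; rewrite ?rmorph0 ?mulr0 ?addr0 //; exact: homog0.
Qed.

Lemma graded_char1 : graded_char 0 1 1.
Proof.
by exists 1, 1, 0; split; rewrite ?rmorph1 ?mulr0 ?addr0 //; exact: homog1.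
Qed.

Lemma graded_charM7 L c p0 :
  graded_char L c p0 -> graded_char L.+1 (char7 * c) p0.
Proof.
move=> [q [p [r [e h s]]]]; exists (X0 * q), p, r; split=> //.
  by rewrite rmorphM /= eval2X0 e.
exact: homogX0.
Qed.

Lemma graded_charM14 L c p0 :
  graded_char L c p0 -> graded_char L.+2 (char14 * c) (X1 * p0).
Proof.
move=> [q [p [r [e h s]]]]; exists (X1 * q), (X1 * p), (X1 * r); split=> //.
- by rewrite rmorphM /= eval2X1 e.
- exact: homogX1.
- by rewrite s; ring.
Qed.

Lemma graded_charN L c : graded_char L c 0 -> graded_char L (- c) 0.
Proof.
by move=> h; have := graded_charB (graded_char0 L) h; rewrite !sub0r oppr0.
Qed.

(** The product formulas are solved for their top term, by induction on the level and then on [a].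
    Multiplication by [char14] handles [a = 0]; otherwise [char7] yields the recurrence of
    [top_poly]. *)
Lemma graded_wchar n (a b : nat) : (a + 2 * b)%N = n ->
  graded_char n (wchar (a%:Z, b%:Z)) (X1 ^+ b * top_poly a).
Proof.
elim/ltn_ind: n a b => n IHn.
have dom (a b : int) : a + 2 * b < n%:Z -> -1 <= b -> -1 <= a ->
    graded_char n (wchar (a, b)) 0.
  move=> lt hb ha; have [->|na] := eqVneq a (-1).
    by rewrite wchar_wall1; exact: graded_char0.
  have [->|nb] := eqVneq b (-1).
    by rewrite wchar_wall2; exact: graded_char0.
  have -> : a = `|a|%N by lia.
  have -> : b = `|b|%N by lia.
  have lt' : (`|a| + 2 * `|b| < n)%N by lia.
  exact: graded_char_lower lt' (IHn _ lt' _ _ erefl).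
(* Lower-level terms left of the chamber return to it, or to a wall, after one reflection. *)
have low (a b : int) : a + 2 * b < n%:Z -> -1 <= b ->
    -1 <= a \/ -1 <= a + b + 1 -> graded_char n (wchar (a, b)) 0.
  move=> lt hb ha; have [?|?] : -1 <= a \/ a <= -2 by lia.
    exact: dom.
  by rewrite wchar_refl1; apply: graded_charN; apply: dom; lia.
elim/ltn_ind => -[|a] IHa b en.
  case: b => [|b] in en *.
    by rewrite -en wchar00 mulr1; exact: graded_char1.
  have h0 := IHn (0 + 2 * b)%N _ 0%N b erefl.
  have {}h0 := graded_charM14 (h0 ltac:(lia)).
  (* Only this term can have second label below -1; that happens for [b = 0], and the long
     reflection moves it back. *)
  have : graded_char n (wchar (3%:Z, b%:Z - 2)) 0.
    case: b en {h0} => [|b] en; last by apply: low; lia.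
    by rewrite wchar_refl2; apply: graded_charN; apply: dom; lia.
  have -> : wchar (0%:Z, b.+1%:Z) = char14 * wchar (0, b%:Z)
    - wchar (0, b%:Z) - wchar (0, b%:Z) - wchar (1, b%:Z)
    - wchar (-1, b%:Z + 1) - wchar (2, b%:Z - 1) - wchar (-2, b%:Z + 1)
    - wchar (1, b%:Z - 1) - wchar (-1, b%:Z) - wchar (0, b%:Z - 1)
    - wchar (3, b%:Z - 1) - wchar (-3, b%:Z + 1) - wchar (-3, b%:Z + 2)
    - wchar (3, b%:Z - 2).
    rewrite wchar_mul14 ?add0r ?sub0r (_ : b.+1%:Z = b%:Z + 1); last by lia.
    by move: (wchar _) => w; ring.
  have -> : X1 ^+ b.+1 * top_poly 0 = X1 * (X1 ^+ b * top_poly 0)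
    - 0 - 0 - 0 - 0 - 0 - 0 - 0 - 0 - 0 - 0 - 0 - 0 - 0.
    by rewrite !subr0 exprS mulrA.
  have eL : (0 + 2 * b).+2 = n by lia.
  rewrite eL in h0.
  by move=> h3; do !(apply: graded_charB => //); apply: low; lia.
have hx := graded_charM7 (IHn (a + 2 * b)%N ltac:(lia) a b erefl).
have eL : (a + 2 * b).+1 = n by lia.
rewrite eL in hx.
(* Besides the top term, only (a-1,b+1) has level [n]: it lies on a wall for [a = 0], and otherwise
   gives the subtracted term of the recurrence. *)
have [p' [ep' h1]] : exists p', X1 ^+ b * top_poly a.+1 =
    X1 ^+ b * top_poly a - p' /\ graded_char n (wchar (a%:Z - 1, b%:Z + 1)) p'.
  case: a IHa {en hx eL} (en) => [|a] IHa en.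
    exists 0; rewrite subr0; split=> //.
    by rewrite wchar_wall1; exact: graded_char0.
  exists (X1 ^+ b.+1 * top_poly a); split; first by rewrite exprSr top_polySS; ring.
  have := IHa a ltac:(lia) b.+1 ltac:(lia).
  by congr (graded_char _ (wchar (_, _)) _); lia.
have -> : wchar (a.+1%:Z, b%:Z) = char7 * wchar (a%:Z, b%:Z)
    - wchar (a%:Z - 1, b%:Z + 1) - wchar (a%:Z + 2, b%:Z - 1)
    - wchar (a%:Z, b%:Z) - wchar (a%:Z - 2, b%:Z + 1)
    - wchar (a%:Z + 1, b%:Z - 1) - wchar (a%:Z - 1, b%:Z).
  rewrite wchar_mul7 (_ : a.+1%:Z = a%:Z + 1); last by lia.
  by ring.
have -> : X1 ^+ b * top_poly a.+1 =
    X1 ^+ b * top_poly a - p' - 0 - 0 - 0 - 0 - 0 by rewrite !subr0.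
by do !(apply: graded_charB => //); apply: low; lia.
Qed.

Lemma Ppoly_spec l :
  homogenizes (level l) (Qpoly l) (Ppoly l) /\
  exists r, Ppoly l = X1 ^+ l.2 * top_poly l.1 + X0 * r.
Proof.
have [q [p [r [eq hp ep]]]] := graded_wchar (erefl (level l)).
have Qq : Qpoly l = q by apply: QpolyE; rewrite eq irrep_charE.
rewrite -Qq in hp.
by rewrite (PpolyE hp); split=> //; exists r.
Qed.

Lemma Qpoly10 : Qpoly (1, 0)%N = X0.
Proof. by apply: QpolyE; rewrite eval2X0 irrep_charE wchar10. Qed.

Lemma Qpoly01 : Qpoly (0, 1)%N = X1.
Proof. by apply: QpolyE; rewrite eval2X1 irrep_charE wchar01. Qed.

Lemma Qpoly20 : Qpoly (2, 0)%N = X0 ^+ 2 - X0 - X1 - 1.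
Proof.
by apply: QpolyE; rewrite !rmorphB rmorph1 rmorphXn /= eval2X0 eval2X1 irrep_charE wchar20.
Qed.

(** A Bezout combination of P_(k+1,0) and P_(k+2,0) has the form 1 + s v, so -v inverts s. *)
Lemma STring_inverse k : exists u : STring k, ring_class _ X0 * u = 1.
Proof.
have [_ [r e]] := Ppoly_spec (k.+1, 0)%N.
have [_ [r' e']] := Ppoly_spec (k.+2, 0)%N.
have {}e : Ppoly (k.+1, 0)%N = top_poly k.+1 + X0 * r by rewrite e expr0 mul1r.
have {}e' : Ppoly (k.+2, 0)%N = top_poly k.+2 + X0 * r' by rewrite e' expr0 mul1r.
have [a [b ab]] := top_poly_bezout k.+1.
exists (ring_class _ (- (a * r + b * r'))).
rewrite -rmorphM -[RHS](rmorph1 (ring_class _)); apply/ring_classP.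
have Pk l : boundary k l -> ideal_gen (Ppoly @` boundary k) (Ppoly l).
  by move=> bl I _; apply; exists l.
have [_ ID IM] := ideal_gen_is_ideal (Ppoly @` boundary k).
have -> : X0 * - (a * r + b * r') - 1
    = - a * Ppoly (k.+1, 0)%N + - b * Ppoly (k.+2, 0)%N.
  by rewrite e e' -ab; ring.
apply: ID; apply: IM; apply: Pk; first by left; rewrite /level /= addn0.
by right.
Qed.

(** * The Verlinde ring *)

Lemma ring_quot_lift (A B : comPzRingType) (S : set A) (f : {rmorphism A -> B}) :
  (forall a, S a -> f a = 0) ->
  exists g : {rmorphism ring_quot S -> B}, forall a, g (ring_class S a) = f a.
Proof.
move=> f0.
have fI a : ideal_gen S a -> f a = 0.
  move=> Ia; apply: (Ia [set b | f b = 0]) => //; split=> /=.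
  - exact: rmorph0.
  - by move=> b c e1 e2; rewrite rmorphD e1 e2 addr0.
  - by move=> b c e; rewrite rmorphM e mulr0.
pose g (u : ring_quot S) := f (repr u).
have gE a : g (ring_class S a) = f a.
  apply/eqP; rewrite -subr_eq0 -rmorphB; apply/eqP/fI/ring_classP.
  by rewrite /ring_class reprK.
have gB : zmod_morphism g.
  elim/ring_classW => a; elim/ring_classW => b.
  by rewrite -rmorphB !gE rmorphB.
have gM : monoid_morphism g.
  split; first by rewrite -(rmorph1 (ring_class S)) gE rmorph1.
  elim/ring_classW => a; elim/ring_classW => b.
  by rewrite -rmorphM !gE rmorphM.
pose ga := GRing.isZmodMorphism.Build (ring_quot S) B g gB.
pose gm := GRing.isMonoidMorphism.Build (ring_quot S) B g gM.
pose G : {rmorphism ring_quot S -> B} := HB.pack g ga gm.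
by exists G.
Qed.

Lemma rmorph_inverse (A B : comPzRingType) (f : {rmorphism A -> B}) :
  bijective f -> exists g : {rmorphism B -> A}, cancel f g /\ cancel g f.
Proof.
move=> [g fK gK].
have gB : zmod_morphism g.
  by move=> a b; apply: (can_inj fK); rewrite rmorphB !gK.
have gM : monoid_morphism g.
  by split=> [|a b]; apply: (can_inj fK); rewrite ?rmorph1 ?rmorphM !gK.
pose ga := GRing.isZmodMorphism.Build B A g gB.
pose gm := GRing.isMonoidMorphism.Build B A g gM.
pose G : {rmorphism B -> A} := HB.pack g ga gm.
by exists G.
Qed.

Lemma inverse_uniq (A : comPzRingType) (a b c : A) : a * b = 1 -> a * c = 1 -> b = c.
Proof. by move=> ab ac; rewrite -[b]mulr1 -ac mulrA [b * a]mulrC ab mul1r. Qed.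

Lemma in_stageMz (C : fusion_ring) (p : simple C) n (f : C) (c : int) :
  in_stage p n f -> in_stage p n (f *~ c).
Proof.
move=> /in_stageP h; apply/in_stageP => i; rewrite raddfMz ffunMzE => nz.
by apply: h; apply: contraNneq nz => ->; rewrite mul0rz.
Qed.

(** * Growth of the stages *)

Section VerlindeG2.
Variables (k : nat) (C : fusion_ring) (W : RepG2 k C).
Hypothesis k_gt0 : (0 < k)%N.
Variable pi10 : simple C.
Hypothesis label10 : label W pi10 = (1, 0)%N.

Local Notation V q := (verlinde W (ring_class _ q)).
Local Notation x := (V X0).
Local Notation y := (V X1).

Lemma V_boundary l : boundary k l -> V (Qpoly l) = 0.
Proof.
move=> bl; rewrite -(rmorph0 (verlinde W)); congr (verlinde W _).
rewrite -(rmorph0 (ring_class _)); apply/ring_classP => I _ SI.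
by rewrite subr0; apply: SI; exists l.
Qed.

Lemma V_surj f : exists q, f = V q.
Proof.
have [g _ gK] := verlinde_bij W; rewrite -[f]gK.
by elim/ring_classW: (g f) => q; exists q.
Qed.

Lemma x_cls : x = cls pi10.
Proof. by rewrite -(verlinde_Q W) label10 Qpoly10. Qed.

Lemma sigma_x : sigma pi10 = x ^+ 2.
Proof. by rewrite /sigma (self_conj W) -x_cls expr2. Qed.

Lemma V_Qpoly_ge0 l : (boundary k l \/ level l <= k)%N ->
  forall i, 0 <= coef (V (Qpoly l)) i.
Proof.
move=> [bl i | lk i]; first by rewrite V_boundary // raddf0 ffunE.
by have [j <-] := (label_range W l).2 lk; rewrite (verlinde_Q W) coef_cls.
Qed.

Lemma sigma_expand : sigma pi10 = V (Qpoly (2, 0)%N) + 1 + y + x.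
Proof. by rewrite sigma_x Qpoly20 !rmorphB !rmorph1 !rmorphXn /= !subrK. Qed.

Lemma coef_x_y_1_ge0 i :
  [/\ 0 <= coef (V (Qpoly (2, 0)%N)) i, 0 <= coef x i, 0 <= coef y i
    & 0 <= coef (1 : C) i].
Proof.
split.
- apply: V_Qpoly_ge0; rewrite /boundary /level /=.
  (* For k = 1 the weight (2,0) has level k+1 and its class is zero; for larger k it labels a simple
     object. The same holds for (0,1) below. *)
  by case: k k_gt0 => [|[|k']] // _; [left; left | right].
- by rewrite x_cls coef_cls.
- rewrite -Qpoly01; apply: V_Qpoly_ge0; rewrite /boundary /level /=.
  by case: k k_gt0 => [|[|k']] // _; [left; left | right].
- by rewrite -cls_unit coef_cls.
Qed.

(** The four summands of [sigma_expand] have nonnegative coefficients, so none of them can be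
    cancelled. *)
Lemma in_stage1 (f : C) : f \in [:: x; y; 1] -> in_stage pi10 1 f.
Proof.
move=> fP; apply/in_stageP => i nz; rewrite expr1 sigma_expand !raddfD !ffunE /=.
have := coef_x_y_1_ge0 i.
have : (coef x i != 0) || (coef y i != 0) || (coef (1 : C) i != 0).
  by move: fP nz; rewrite !inE => /or3P[] /eqP-> ->; rewrite ?orbT.
move: (coef x i) (coef y i) (coef (1 : C) i) (coef (V (Qpoly (2, 0)%N)) i).
by move=> a b c e abc0 [h1 h2 h3 h4]; apply: lt0r_neq0; lia.
Qed.

Lemma in_stageW n m f : (n <= m)%N -> in_stage pi10 n f -> in_stage pi10 m f.
Proof.
move=> /subnK <- h; elim: (m - n)%N => // d IH; rewrite addSn -addn1 -[f]mulr1.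
by apply: in_stageM => //; apply: in_stage1; rewrite !inE eqxx !orbT.
Qed.

Lemma in_stageX n (f : C) : in_stage pi10 1 f -> in_stage pi10 n (f ^+ n).
Proof.
move=> h; elim: n => [|n IH]; first by rewrite expr0; exact: (in_stage_sigmaX pi10 0).
by rewrite exprS -add1n; apply: in_stageM.
Qed.

(** x and y generate the fusion ring, and the monomial x^i y^j lies in stage i+j. *)
Lemma exists_stage f : exists n, in_stage pi10 n f.
Proof.
have [q ->] := V_surj f.
have /= -> := ZP_morphE (verlinde W \o ring_class (Qpoly @` boundary k)) q.
elim: (msupp q) => [|m s [n IH]]; first by exists 0%N; rewrite big_nil in_stage0.
have mon : in_stage pi10 (m ord0 + m ord_max)
    (x ^+ m ord0 * y ^+ m ord_max *~ q@_m).
  apply: in_stageMz; apply: in_stageM; apply: in_stageX; apply: in_stage1.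
    by rewrite !inE eqxx.
  by rewrite !inE eqxx orbT.
exists (m ord0 + m ord_max + n)%N; rewrite big_cons; apply: in_stageD.
  by apply: in_stageW mon; rewrite leq_addr.
by apply: in_stageW IH; rewrite leq_addl.
Qed.

Lemma exists_full_stage : exists N, forall f, in_stage pi10 N f.
Proof.
have [nu nuP] := choice (fun i : simple C => exists_stage (cls i)).
exists (\max_i nu i) => f; apply/in_stageP => i _.
have /in_stageP := in_stageW (leq_bigmax i) (nuP i).
by apply; rewrite coef_cls eqxx.
Qed.

End VerlindeG2.

(** * Homomorphisms out of and into K_0 *)

Section K0Maps.
Variables (C : fusion_ring) (p : simple C).

Lemma K0_class_repr (w : K0 p) : K0_class (valP (repr w)) = w.
Proof.
rewrite -[RHS]reprK; congr (\pi_(K0 p) _).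
by apply: val_inj; case: (repr w) => -[].
Qed.

(** The universal property of inverting sigma, with [c] in the role of its inverse. *)
Lemma K0_lift (A : comPzRingType) (f : {rmorphism C -> A}) (c : A) :
  c * f (sigma p) = 1 ->
  exists h : {rmorphism K0 p -> A},
    forall n a (ha : in_stage p n a), h (K0_class ha) = c ^+ n * f a.
Proof.
move=> c1.
have cX i a : c ^+ i * f (sigma p ^+ i * a) = f a.
  by rewrite rmorphM rmorphXn mulrA -exprMn c1 expr1n mul1r.
pose h (w : K0 p) := c ^+ (val (repr w)).1 * f (val (repr w)).2.
have hE n a (ha : in_stage p n a) : h (K0_class ha) = c ^+ n * f a.
  rewrite /h; have := K0_class_repr (K0_class ha).
  case/K0_classP => i [j [e1 e2]].
  by rewrite -(cX i) mulrA -exprD e1 e2 exprD -mulrA cX.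
have hD : {morph h : u v / u + v}.
  elim/K0_classW => n a ha; elim/K0_classW => m b hb.
  rewrite [_ + _](K0_addE ha hb (lim_add_stage (Staged ha) (Staged hb))) !hE /=.
  rewrite rmorphD mulrDr; congr (_ + _); first by rewrite exprD -mulrA cX.
  by rewrite addnC exprD -mulrA cX.
have hN : {morph h : u / - u}.
  elim/K0_classW => n a ha; rewrite [- _](K0_oppE ha (in_stageN ha)) !hE.
  by rewrite rmorphN mulrN.
have hB : zmod_morphism h by move=> u v; rewrite hD hN.
have hM : monoid_morphism h.
  split; first by rewrite (hE 0 _ (in_stage_sigmaX p 0)) !expr0 rmorph1 mulr1.
  elim/K0_classW => n a ha; elim/K0_classW => m b hb.
  by rewrite [_ * _](K0_mulE ha hb (in_stageM ha hb)) !hE rmorphM exprD mulrACA.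
pose fa := GRing.isZmodMorphism.Build (K0 p) A h hB.
pose fm := GRing.isMonoidMorphism.Build (K0 p) A h hM.
pose H : {rmorphism K0 p -> A} := HB.pack h fa fm.
by exists H.
Qed.

(** An element need not lie in stage 0, so it is represented as sigma^N a over sigma^N. *)
Lemma K0_embed N (full : forall a, in_stage p N a) :
  exists iota : {rmorphism C -> K0 p},
    forall a, iota a = K0_class (full (sigma p ^+ N * a)).
Proof.
pose f a : K0 p := K0_class (full (sigma p ^+ N * a)).
have fD : {morph f : a b / a + b}.
  move=> a b; set ha := full (sigma p ^+ N * a); set hb := full (sigma p ^+ N * b).
  rewrite [f a + f b](K0_addE ha hb (lim_add_stage (Staged ha) (Staged hb))) /=.
  by apply/K0_classP; exists N, 0%N; rewrite addn0 mul1r !mulrDr.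
have fN : {morph f : a / - a}.
  move=> a; set ha := full (sigma p ^+ N * a).
  by rewrite [- f a](K0_oppE ha (in_stageN ha)); apply: K0_eq; rewrite // mulrN.
have fB : zmod_morphism f by move=> a b; rewrite fD fN.
have fM : monoid_morphism f.
  split; first by apply/K0_classP; exists 0%N, N; rewrite addn0 mul1r mulrC.
  move=> a b; set ha := full (sigma p ^+ N * a); set hb := full (sigma p ^+ N * b).
  rewrite [f a * f b](K0_mulE ha hb (in_stageM ha hb)).
  by apply/K0_classP; exists N, 0%N; rewrite addn0 mul1r mulrACA mulrA.
pose fa := GRing.isZmodMorphism.Build C (K0 p) f fB.
pose fm := GRing.isMonoidMorphism.Build C (K0 p) f fM.
pose F : {rmorphism C -> K0 p} := HB.pack f fa fm.
by exists F.
Qed.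

End K0Maps.

Lemma expr_unit_eq0 (A : comPzRingType) (a b c : A) n :
  a * b = 1 -> a ^+ n * c = 0 -> c = 0.
Proof.
move=> ab e; rewrite -[c]mul1r -(expr1n _ n) -ab exprMn.
by rewrite [a ^+ n * _]mulrC -mulrA e mulr0.
Qed.

(** * The isomorphism of K_0 with Z[s,t]/I_k *)

Section Iso.
Variables (k : nat) (C : fusion_ring) (W : RepG2 k C).
Hypothesis k_gt0 : (0 < k)%N.
Variable pi10 : simple C.
Hypothesis label10 : label W pi10 = (1, 0)%N.

Local Notation V q := (verlinde W (ring_class _ q)).
Local Notation x := (V X0).
Local Notation y := (V X1).
Local Notation st q := (ring_class (Ppoly @` boundary k) q).

Lemma verlinde_lift (A : comPzRingType) (f : {rmorphism ZP -> A}) :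
  (forall l, boundary k l -> f (Qpoly l) = 0) ->
  exists F : {rmorphism C -> A}, forall q, F (V q) = f q.
Proof.
move=> f0; have f0' a : (Qpoly @` boundary k) a -> f a = 0.
  by move=> [l bl <-]; apply: f0.
have [g gE] := ring_quot_lift f0'.
have [v [vK _]] := rmorph_inverse (verlinde_bij W).
by exists (g \o v) => q /=; rewrite vK gE.
Qed.

(** Homogenization sends P_l to a power of s times the image of Q_l, which vanishes for [l] in the
    boundary. *)
Lemma STring_lift (A : comPzRingType) (f : {rmorphism C -> A})
    (g : {rmorphism ZP -> A}) :
  g X0 * f x = 1 -> g X1 = f y * g X0 ^+ 2 ->
  exists G : {rmorphism STring k -> A}, forall p, G (st p) = g p.
Proof.
move=> e0 e1; apply: ring_quot_lift => _ [l bl <-].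
have [hP _] := Ppoly_spec l.
pose fV : {rmorphism ZP -> A} := f \o (verlinde W \o ring_class (Qpoly @` boundary k)).
by rewrite (hP A fV g) //= V_boundary // rmorph0 mulr0.
Qed.

Lemma verlinde_ext (A : comPzRingType) (f g : {rmorphism C -> A}) :
  f x = g x -> f y = g y -> f =1 g.
Proof.
move=> ex ey a; have [q ->] := V_surj W a.
pose v : {rmorphism ZP -> C} := verlinde W \o ring_class (Qpoly @` boundary k).
exact: (@ZP_morph_eq A (f \o v) (g \o v)).
Qed.

Lemma verlinde_to_STring :
  exists psi : {rmorphism C -> STring k},
    st X0 * psi x = 1 /\ psi y = st X1 * psi x ^+ 2.
Proof.
have [u su] := STring_inverse k.
have [f [f0 f1]] := exists_ZP_morph u (st X1 * u ^+ 2).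
have fQ l : boundary k l -> f (Qpoly l) = 0.
  move=> bl; have [hP _] := Ppoly_spec l.
  have Pl : st (Ppoly l) = 0.
    rewrite -(rmorph0 (ring_class _)); apply/ring_classP => I _ SI.
    by rewrite subr0; apply: SI; exists l.
  (* Here 0 = P_l = s^L Q_l(u, t u^2) with [L = level l], and s is a unit. *)
  have := hP _ f (ring_class (Ppoly @` boundary k)).
  rewrite /= f0 f1 Pl -mulrA -exprMn [u * _]mulrC su expr1n mulr1 => /(_ erefl erefl) e.
  exact: expr_unit_eq0 su (esym e).
have [psi psiE] := verlinde_lift fQ.
by exists psi; rewrite !psiE f0 f1.
Qed.

Lemma K0_STring :
  exists (psi : {rmorphism C -> STring k}) (h : {rmorphism K0 pi10 -> STring k}),
    [/\ st X0 * psi x = 1, psi y = st X1 * psi x ^+ 2, bijective h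
      & forall n a (ha : in_stage pi10 n a),
          h (K0_class ha) = (st X0 ^+ 2) ^+ n * psi a].
Proof.
have [psi [sx ty]] := verlinde_to_STring.
have s2 : st X0 ^+ 2 * psi (sigma pi10) = 1.
  by rewrite (sigma_x label10) rmorphXn -exprMn sx expr1n.
have [h hE] := K0_lift s2.
exists psi, h; split=> //.
have [N full] := exists_full_stage k_gt0 label10.
have [iota iotaE] := K0_embed full.
have in1 f : f \in [:: x; y; 1] -> in_stage pi10 1 f by exact: in_stage1.
have sx1 : in_stage pi10 1 x by apply: in1; rewrite !inE eqxx.
have sy1 : in_stage pi10 1 y by apply: in1; rewrite !inE eqxx orbT.
(* The inverse of [h] sends s and t to x and y at stage 1, that is, to x/x^2 and y/x^2. *)
pose s' := K0_class sx1; pose t' := K0_class sy1.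
have hs' : h s' = st X0 by rewrite hE expr1 expr2 -mulrA sx mulr1.
have ht' : h t' = st X1.
  by rewrite hE expr1 ty mulrCA -exprMn sx expr1n mulr1.
have mulK n a (ha : in_stage pi10 n a) m b (hb : in_stage pi10 m b) :
    K0_class ha * K0_class hb = K0_class (in_stageM ha hb).
  by rewrite [LHS](K0_mulE ha hb (in_stageM ha hb)).
have s'X n : s' ^+ n = K0_class (in_stageX n sx1).
  elim: n => [|n IH]; first by rewrite expr0; apply: K0_eq; rewrite ?expr0.
  by rewrite exprS IH mulK; apply: K0_eq; rewrite // exprS.
have eq_iota n a (ha : in_stage pi10 n a) : K0_class ha = s' ^+ (2 * n) * iota a.
  rewrite s'X iotaE mulK; apply/K0_classP; exists (n + N)%N, 0%N.
  split; first by lia.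
  by rewrite mul1r exprM -(sigma_x label10) exprD mulrA.
(* Sigma at stage 1 is the unit, so (s' x)^2 = 1; combined with s' = s'^2 x this gives s' x = 1. *)
have s'x : s' * iota x = 1.
  have := eq_iota _ _ (in_stage_sigmaX pi10 1).
  have <- : 1 = K0_class (in_stage_sigmaX pi10 1).
    by apply/K0_classP; exists 1%N, 0%N; split; rewrite // mulrC.
  rewrite muln1 expr1 (sigma_x label10) rmorphXn -exprMn => e.
  have e1 : s' = s' ^+ 2 * iota x.
    rewrite {1}/s' (eq_iota _ _ sx1) muln1 //.
  by rewrite {1}e1 -mulrA -expr2 -exprMn -e.
have t'E : t' = iota y * s' ^+ 2 by rewrite {1}/t' eq_iota muln1 mulrC.
have [g0 [g00 g01]] := exists_ZP_morph s' t'.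
have [g gE] : exists G : {rmorphism STring k -> K0 pi10}, forall p, G (st p) = g0 p.
  by apply: (@STring_lift _ iota); rewrite g00 // g01.
have hg q : h (g (st q)) = st q.
  apply: (@ZP_morph_eq _ (h \o (g \o ring_class (Ppoly @` boundary k)))
            (ring_class (Ppoly @` boundary k))) => /=.
    by rewrite gE g00.
  by rewrite gE g01.
have gpsi : g \o psi =1 iota.
  have gx : g (psi x) = iota x.
    apply: (@inverse_uniq _ s') => //.
    by rewrite -g00 -gE -rmorphM sx rmorph1.
  apply: verlinde_ext => //=.
  rewrite ty rmorphM rmorphXn gx gE g01 t'E -mulrA -exprMn s'x.
  by rewrite expr1n mulr1.
exists g.
  elim/K0_classW => n a ha; rewrite hE rmorphM !rmorphXn -exprM gE g00.
  by rewrite [g (psi a)]gpsi -eq_iota.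
by elim/ring_classW => q; exact: hg.
Qed.

End Iso.

(** * Positivity *)

(** Adding a large integer makes any value of [e] positive; this gives both differences of positive
    elements and the order unit. *)
Lemma cone_ordered (A : comPzRingType) (R : realType) (e : {rmorphism A -> R}) :
  ordered_ring [set a | 0 < e a \/ a = 0].
Proof.
have arch (r : R) : exists2 n : nat, (0 < n)%N & `|r| < n%:R.
  exists (Num.bound `|r|).+1 => //; apply: lt_trans (archi_boundP (normr_ge0 r)) _.
  by rewrite ltr_nat.
split=> /=.
- move=> a b [pa|->] [pb|->]; rewrite ?addr0 ?add0r; [|by left|by left|by right].
  by left; rewrite rmorphD addr_gt0.
- move=> a; split=> [[[pa|//] [pa'|/eqP]]|->].
  + by move: pa'; rewrite rmorphN oppr_gt0 => /(lt_trans pa); rewrite ltxx.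
  + by rewrite oppr_eq0 => /eqP.
  + by rewrite oppr0; split; right.
- move=> a; have [n n0 nP] := arch (e a); exists (a + n%:R), n%:R.
  split; [left|left|by rewrite addrK].
    rewrite rmorphD rmorph_nat; move: nP; rewrite ltr_norml => /andP[]; lra.
  by rewrite rmorph_nat ltr0n.
- move=> a b [pa|->] [pb|->]; rewrite ?mulr0 ?mul0r; [|by right|by right|by right].
  by left; rewrite rmorphM mulr_gt0.
- split; first by left; rewrite rmorph1 ltr01.
  move=> a; have [n n0 nP] := arch (e a); exists n; left.
  rewrite rmorphB rmorph_nat subr_gt0; move: nP; rewrite ltr_norml => /andP[_]; lra.
Qed.

(** Every row puts mass at least [e] on [j0], pulling both bounds towards [h j0]; their distance
    shrinks by the factor 1 - e. *)
Lemma stochastic_contraction (R : realFieldType) (I : finType) (P : I -> I -> R)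
    (e lo hi : R) (j0 : I) (h : I -> R) :
  (forall i j, 0 <= P i j) -> (forall i, \sum_j P i j = 1) ->
  (forall i, e <= P i j0) -> (forall i, lo <= h i <= hi) ->
  forall i, lo + e * (h j0 - lo) <= \sum_j P i j * h j <= hi - e * (hi - h j0).
Proof.
move=> P0 P1 Pe hb i; have hle j := andP (hb j).
have lhs : e * (h j0 - lo) <= \sum_j P i j * (h j - lo).
  rewrite (bigD1 j0) //= -[leLHS]addr0; apply: lerD.
    by rewrite ler_wpM2r // subr_ge0; case: (hle j0).
  by apply: sumr_ge0 => j _; rewrite mulr_ge0 // subr_ge0; case: (hle j).
have rhs : e * (hi - h j0) <= \sum_j P i j * (hi - h j).
  rewrite (bigD1 j0) //= -[leLHS]addr0; apply: lerD.
    by rewrite ler_wpM2r // subr_ge0; case: (hle j0).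
  by apply: sumr_ge0 => j _; rewrite mulr_ge0 // subr_ge0; case: (hle j).
have sum_c (c : R) : \sum_j P i j * c = c by rewrite -mulr_suml P1 mul1r.
have dist_lo : \sum_j P i j * (h j - lo) = \sum_j P i j * h j - lo.
  by under eq_bigr do rewrite mulrBr; rewrite sumrB sum_c.
have dist_hi : \sum_j P i j * (hi - h j) = hi - \sum_j P i j * h j.
  by under eq_bigr do rewrite mulrBr; rewrite sumrB sum_c.
by rewrite dist_lo in lhs; rewrite dist_hi in rhs; apply/andP; split; lra.
Qed.

(** From the Bernoulli-type bound (1-e)^n (1+ne) <= 1, with n chosen so that n e m exceeds c. *)
Lemma expr_lt_small (R : realType) (c e m : R) : 0 < e <= 1 -> 0 < m ->
  exists n, c * (1 - e) ^+ n < m.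
Proof.
move=> /andP[e0 e1] m0.
have bern n : (1 - e) ^+ n * (1 + n%:R * e) <= 1.
  elim: n => [|n IH]; first by rewrite expr0 mul0r addr0 mulr1.
  apply: le_trans IH; rewrite exprSr -mulrA ler_wpM2l ?exprn_ge0 ?subr_ge0 //.
  rewrite -addn1 natrD; have n0 : 0 <= n%:R :> R by []; nra.
have em : 0 < e * m by rewrite mulr_gt0.
exists (Num.bound `|c / (e * m)|); set n := Num.bound _.
have nP : `|c| < n%:R * (e * m).
  rewrite -ltr_pdivrMr // -(gtr0_norm em) -normf_div.
  exact: archi_boundP.
have [c0|c0] := leP c 0.
  apply: le_lt_trans m0; rewrite mulr_le0_ge0 // exprn_ge0 // subr_ge0 //.
have x0 : 0 <= (1 - e) ^+ n by rewrite exprn_ge0 // subr_ge0.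
move: (bern n) nP; rewrite gtr0_norm //; move: x0; move: (_ ^+ n) => z z0 zb cb.
have d0 : 0 < 1 + n%:R * e by rewrite ltr_pwDl // mulr_ge0 // ltW.
rewrite -(ltr_pM2r d0) -mulrA.
apply: (@le_lt_trans _ _ c); first by rewrite -[leRHS]mulr1 ler_wpM2l // ltW.
by nra.
Qed.

(** * The Perron-Frobenius argument *)

Section PerronFrobenius.
Variables (C : fusion_ring) (R : realType) (d : {rmorphism C -> R}).
Hypothesis d_gt0 : quantum_dim d.
Hypothesis self_dual : forall i : simple C, conj_obj i = i.

Lemma coef_unit (f : C) i : coef f i = coef (f * cls i) (unit_obj C).
Proof.
rewrite {2}[f]Defs.coefK mulr_suml raddf_sum sum_ffunE (bigD1 i) //= big1 => [|j nji].
  by rewrite mulrzAl raddfMz ffunMzE coef_conj self_dual eqxx addr0 intz.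
by rewrite mulrzAl raddfMz ffunMzE coef_conj self_dual eq_sym (negPf nji) mul0rz.
Qed.

(** Frobenius reciprocity for self-dual objects: multiplication by [f] has a symmetric matrix, so
    the quantum dimensions form an eigenvector. *)
Lemma coefM_sym (f : C) i j : coef (f * cls i) j = coef (f * cls j) i.
Proof. by rewrite coef_unit [RHS]coef_unit mulrAC. Qed.

Lemma coefMl (a f : C) i : coef (a * f) i = \sum_j coef f j * coef (a * cls j) i.
Proof.
rewrite {1}[f]Defs.coefK mulr_sumr raddf_sum sum_ffunE; apply: eq_bigr => j _.
by rewrite mulrzAr raddfMz ffunMzE -mulrzr intz mulrC.
Qed.

Lemma d_coef (f : C) : d f = \sum_j (coef f j)%:~R * d (cls j).
Proof.
rewrite {1}[f]Defs.coefK rmorph_sum; apply: eq_bigr => j _.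
by rewrite rmorphMz -mulrzl.
Qed.

(* The matrix of multiplication by [a], conjugated by the quantum dimensions
   and divided by [d a], is stochastic; it contracts oscillations because [a]
   contains every simple object, and it fixes the weighted mean [d f]. *)
Lemma perron_frobenius (a f : C) :
  (forall i, 0 < coef a i) -> 0 < d f ->
  exists n, forall i, 0 <= coef (a ^+ n * f) i.
Proof.
move=> a0 df; pose w i := d (cls i); have w0 i : 0 < w i by exact: d_gt0.
have am0 i j : 0 <= coef (a * cls j) i.
  apply: coef_mul_ge0 => l; first exact: ltW.
  by rewrite coef_cls.
have Dw i : d a * w i = \sum_j (coef (a * cls j) i)%:~R * w j.
  rewrite /w -rmorphM d_coef; apply: eq_bigr => j _.
  by rewrite coefM_sym.
pose o := unit_obj C.
have wo : w o = 1 by rewrite /w cls_unit rmorph1.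
have D0 : 0 < d a.
  rewrite d_coef (bigD1 o) //= ltr_pwDl //.
    by rewrite mulr_gt0 // ltr0z.
  by apply: sumr_ge0 => j _; apply: mulr_ge0; rewrite ?ler0z ltW.
pose P i j := (coef (a * cls j) i)%:~R * w j / (d a * w i).
have Dw0 i : 0 < d a * w i by rewrite mulr_gt0.
have P0 i j : 0 <= P i j.
  by rewrite divr_ge0 ?(ltW (Dw0 i)) // mulr_ge0 ?ler0z // ltW.
have P1 i : \sum_j P i j = 1.
  by rewrite -mulr_suml -Dw divff // gt_eqF.
pose B := \sum_i w i.
have wB i : w i <= B.
  by rewrite /B (bigD1 i) //= lerDl sumr_ge0 // => j _; rewrite ltW.
have B0 : 0 < B := lt_le_trans (w0 o) (wB o).
(* A lower bound for the column of the unit object: the integers [coef a i] are at least 1 and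
   [w i <= B]. *)
pose e := (d a * B)^-1.
have e0 : 0 < e by rewrite invr_gt0 mulr_gt0.
have Pe i : e <= P i o.
  rewrite /P wo mulr1 cls_unit mulr1.
  apply: (@le_trans _ _ (d a * w i)^-1).
    by rewrite lef_pV2 ?posrE ?mulr_gt0 // ler_wpM2l // ltW.
  rewrite -[leLHS]mul1r ler_wpM2r ?invr_ge0 ?(ltW (Dw0 i)) //.
  by rewrite -[1]/(1%:~R) ler_int -gtz0_ge1.
have e1 : e <= 1.
  apply: le_trans (Pe o) _; rewrite -(P1 o) (bigD1 o) //= lerDl sumr_ge0 //.
pose h n i := (coef (a ^+ n * f) i)%:~R / (w i * d a ^+ n).
have hS n i : h n.+1 i = \sum_j P i j * h n j.
  rewrite /h exprS -mulrA coefMl rmorph_sum mulr_suml; apply: eq_bigr => j _.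
  rewrite rmorphM /P exprS /=.
  have n0 : d a ^+ n != 0 by rewrite expf_neq0 // gt_eqF.
  have wi0 : w i != 0 by rewrite gt_eqF.
  have wj0 : w j != 0 by rewrite gt_eqF.
  have da0 : d a != 0 by rewrite gt_eqF.
  move: (w i) (w j) (d a) (d a ^+ n) wi0 wj0 da0 n0 => wi wj da dan wi0 wj0 da0 n0.
  by field; rewrite wi0 wj0 da0 n0.
(* The mean of [h n] with weights w_i^2 is independent of [n], since [d] is multiplicative. *)
have mean n : \sum_i w i ^+ 2 * h n i = d f.
  have dan0 : d a ^+ n != 0 by rewrite expf_neq0 // gt_eqF.
  have -> : d f = d (a ^+ n * f) / d a ^+ n.
    by rewrite rmorphM rmorphXn mulrAC divff // mul1r.
  rewrite d_coef mulr_suml; apply: eq_bigr => i _; rewrite /h -/(w i).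
  have wi0 : w i != 0 by rewrite gt_eqF.
  move: (w i) (d a ^+ n) wi0 dan0 => wi dan wi0 dan0.
  by field; rewrite wi0 dan0.
pose c := \sum_i `|h 0%N i|.
have osc n : exists lo hi, (forall i, lo <= h n i <= hi)
    /\ hi - lo = (c + c) * (1 - e) ^+ n.
  elim: n => [|n [lo [hi [hb hw]]]].
    exists (- c), c; split=> [i|]; last by rewrite opprK expr0 mulr1.
    rewrite -ler_norml /c (bigD1 i) //= lerDl sumr_ge0 //.
  exists (lo + e * (h n o - lo)), (hi - e * (hi - h n o)); split=> [i|].
    by rewrite hS; exact: stochastic_contraction.
  by rewrite exprSr mulrA -hw; ring.
pose S := \sum_i w i ^+ 2.
have S0 : 0 < S.
  rewrite /S (bigD1 o) //= ltr_pwDl ?exprn_gt0 // sumr_ge0 // => i _.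
  by rewrite exprn_ge0 // ltW.
(* Once the oscillation is below the mean d f / S, which is at most [hi], the lower bound [lo] is
   positive. *)
have [n nP] : exists n, (c + c) * (1 - e) ^+ n < d f / S.
  by apply: expr_lt_small; rewrite ?e0 ?e1 ?divr_gt0.
exists n => i; have [lo [hi [hb hw]]] := osc n.
have hi_ge : d f / S <= hi.
  rewrite ler_pdivrMr // -(mean n) mulrC /S mulr_suml; apply: ler_sum => j _.
  by rewrite ler_wpM2l ?exprn_ge0 ?(ltW (w0 j)) //; case/andP: (hb j).
have : 0 < h n i by case/andP: (hb i) => l1 _; apply: lt_le_trans l1; lra.
rewrite /h pmulr_lgt0 ?invr_gt0 ?mulr_gt0 ?exprn_gt0 //.
by rewrite ltr0z => /ltW.
Qed.

End PerronFrobenius.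

(** * Matching the positive cones *)

Theorem theorem4p25 (R : realType) (k : nat) (hk : (0 < k)%N)
    (C : fusion_ring) (W : RepG2 k C)
    (pi10 : simple C) (hpi10 : label W pi10 = (1%N, 0%N))
    (d : {rmorphism C -> R}) (hd : quantum_dim d)
    (b1 b2 : R)
    (hb1 : b1 = (d (verlinde W (ring_class _ 'X_ord0)))^-1)
    (hb2 : b2 = (d (verlinde W (ring_class _ 'X_ord0))) ^- 2
                * d (verlinde W (ring_class _ 'X_ord_max))) :
  ordered_ring_iso (K0_pos (p := pi10)) (STpos (k := k) b1 b2).
Proof.
have [psi [h [sx ty hbij hE]]] := K0_STring hk hpi10.
set x := verlinde W (ring_class _ 'X_ord0) in sx ty hb1 hb2.
set y := verlinde W (ring_class _ 'X_ord_max) in ty hb2.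
have xE : x = cls pi10 := x_cls hpi10.
have dx0 : 0 < d x by rewrite xE; exact: hd.
have b1x : b1 * d x = 1 by rewrite hb1 mulVf // gt_eqF.
have b10 : 0 < b1 by rewrite hb1 invr_gt0.
have b2E : b2 = d y * b1 ^+ 2 by rewrite hb2 hb1 exprVn mulrC.
(* Evaluation at (b1, b2) descends to the quotient because b1 = 1/d(x) and b2 = d(y)/d(x)^2; both
   cones are then described by [ev]. *)
have [ev evE] : exists ev : {rmorphism STring k -> R},
    forall p, ev (ring_class _ p) = eval2 b1 b2 p.
  by apply: (@STring_lift _ _ W _ d (eval2 b1 b2)) => /=; rewrite eval2X0 ?eval2X1.
have ev_psi : ev \o psi =1 d.
  have evx : ev (psi x) = d x.
    apply: (@inverse_uniq _ b1) => //.
    by rewrite -[X in X * _](eval2X0 b1 b2) -evE -rmorphM sx rmorph1.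
  apply: (@verlinde_ext _ _ W) => //.
  rewrite /= -/y ty rmorphM rmorphXn evx evE eval2X1 b2E -mulrA -exprMn b1x.
  by rewrite expr1n mulr1.
have ev_h n a (ha : in_stage pi10 n a) :
    ev (h (K0_class ha)) = (b1 ^+ 2) ^+ n * d a.
  by rewrite hE rmorphM !rmorphXn evE eval2X0 [ev (psi a)]ev_psi.
have STposE : STpos b1 b2 = [set v : STring k | 0 < ev v \/ v = 0].
  apply/seteqP; split=> v /=.
    by move=> [[p /= p0 <-]|->]; [left; rewrite evE | right].
  by elim/ring_classW: v => p [p0|->]; [left; exists p; rewrite //= -evE | right].
have hinj : injective h := bij_inj hbij.
have K0posE : K0_pos (p := pi10) = [set u | 0 < (ev \o h) u \/ u = 0].
  apply/seteqP; split=> u /=.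
    move=> [n [f [hf [f0 ->]]]].
    have [fz|nf] := eqVneq f 0.
      right; apply/K0_classP; exists 0%N, n.
      by rewrite fz addn0 !mulr0.
    left; rewrite ev_h mulr_gt0 ?exprn_gt0 // d_coef.
    have [i fi] : exists i, coef f i != 0.
      apply/existsP; apply: contraNT nf; rewrite negb_exists => /forallP f0'.
      rewrite [f]Defs.coefK big1 // => i _.
      by have := f0' i; rewrite negbK => /eqP->.
    rewrite (bigD1 i) //= ltr_pwDl //.
      by rewrite mulr_gt0 ?ltr0z ?hd // lt_def fi f0.
    by apply: sumr_ge0 => j _; rewrite mulr_ge0 ?ler0z // ltW ?hd.
  move=> [|->]; last first.
    by exists 0%N, 0, (in_stage0 pi10 0); split=> // i; rewrite raddf0 ffunE.
  elim/K0_classW: u => n f hf; rewrite ev_h pmulr_rgt0 ?exprn_gt0 // => df.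
  have [N full] := exists_full_stage hk hpi10.
  (* At a full stage [N] every coefficient of sigma^N is positive, so a power of it makes [f]
     nonnegative; passing to the later stage does not change the class. *)
  have [|m mP] := perron_frobenius hd (self_conj W) (a := sigma pi10 ^+ N) _ df.
    move=> i; rewrite lt_def coef_sigmaX_ge0 andbT.
    by have /in_stageP := full (cls i); apply; rewrite coef_cls eqxx.
  rewrite -exprM in mP.
  exists (N * m + n)%N, (sigma pi10 ^+ (N * m) * f).
  exists (in_stageM (in_stage_sigmaX pi10 (N * m)) hf); split=> //.
  by apply/K0_classP; exists (N * m)%N, 0%N; rewrite addn0 addnC mul1r.
split.
- by rewrite K0posE; exact: cone_ordered.
- by rewrite STposE; exact: cone_ordered.
exists h; split=> //; rewrite K0posE STposE; apply/seteqP; split=> v /=.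
  by move=> [u [u0|->] <-]; [left | right; rewrite rmorph0].
have [g _ gK] := hbij.
move=> v0; exists (g v); last exact: gK.
case: v0 => [v0|->]; [left; rewrite /= gK // | right].
by apply: hinj; rewrite gK rmorph0.
Qed.
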